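(* There exist functions $\varepsilon_1,\varepsilon_2:(0,1)\to\mathbb{R}$ with $\lim_{\alpha\to 0^+}\varepsilon_1(\alpha)=\lim_{\alpha\to 0^+}\varepsilon_2(\alpha)=0$ such that for every real $0<\alpha<1$ the following two statements hold. (1) There is a set $A$ of positive integers of lower density $\alpha$ with $\gcd(A)=1$ satisfying $$\liminf_{n\to\infty}\frac{\log p_A(n)}{\log p(\alpha n)}\geq (1-\varepsilon_1(\alpha))\,\frac{\sqrt{6}}{\pi}\,\log(1/\alpha).$$ (2) Every set $A$ of positive integers of lower density $\alpha$ satisfies $$\liminf_{n\to\infty}\frac{\log p_A(n)}{\log p(\alpha n)}\leq (1+\varepsilon_2(\alpha))\,\frac{\sqrt{6}}{\pi}\,\log(1/\alpha).$$
   Context: For a set $A$ of positive integers, $p_A(n)$ denotes the number of partitions of $n$ using integers from $A$, i.e. the number of multisets of elements of $A$ (repetitions allowed, order irrelevant) whose sum is $n$. $p(n)=p_{\{1,2,3,\ldots\}}(n)$ is the usual partition function, and $p(\alpha n)$ means $p(\lfloor \alpha n\rfloor)$. Logarithms are natural; $\log 0=-\infty$, and limits inferior are taken in the extended reals (only large $n$, for which $\log p(\lfloor\alpha n\rfloor)>0$, matter). The lower density of $A$ is $\liminf_{n\to\infty}|A\cap\{1,\ldots,n\}|/n$. $\gcd(A)$ is the greatest common divisor of all elements of $A$. The notation $o_\alpha(1)$ in the source means a quantity depending on $\alpha$ that tends to $0$ as $\alpha\to 0$; it is written out here as the functions $\varepsilon_1,\varepsilon_2$. *)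

(* Defs.v *)
From HB Require Import structures.
From mathcomp Require Import all_boot all_order all_algebra.
From mathcomp Require Import all_classical all_reals all_analysis.

Set Implicit Arguments.
Unset Strict Implicit.
Unset Printing Implicit Defensive.

Import Order.TTheory GRing.Theory Num.Theory.
Import numFieldNormedType.Exports.

Local Open Scope ring_scope.

Definition all_positive (A : set nat) : Prop := forall a, A a -> (0 < a)%N.

(* A multiset of elements of A with sum n is encoded by its multiplicity
   function m, where m i is the multiplicity of the part i. When A consists of
   positive integers, parts and multiplicities are at most n, so bounding both
   by n loses nothing. *)
Definition partitions (A : set nat) (n : nat) :
    {set {ffun 'I_n.+1 -> 'I_n.+1}} :=
  [set m : {ffun 'I_n.+1 -> 'I_n.+1} |
    [forall i, (0 < m i)%N ==> (val i \in A)] &&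
    (\sum_(i < n.+1) m i * i == n)%N]%SET.

Definition num_partitions (A : set nat) (n : nat) : nat := #|partitions A n|.

Definition partition_number (n : nat) : nat :=
  num_partitions [set k | (0 < k)%N]%classic n.

Definition count_upto (A : set nat) (n : nat) : nat :=
  #|[set k : 'I_n.+1 | (0 < k)%N && (val k \in A)]%SET|.

Definition natural_lower_density (R : realType) (A : set nat) : \bar R :=
  limn_einf (fun n : nat => ((count_upto A n)%:R / n%:R : R)%:E).

Definition is_gcd (A : set nat) (g : nat) : Prop :=
  (forall a, A a -> (g %| a)%N) /\
  (forall d, (forall a, A a -> (d %| a)%N) -> (d %| g)%N).

(* lne 0 = -oo, and Num.truncn is the floor on nonnegative reals. *)
Definition log_ratio (R : realType) (A : set nat) (alpha : R) (n : nat) :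
    \bar R :=
  (lne (num_partitions A n)%:R%:E /
   lne (partition_number (Num.truncn (alpha * n%:R)))%:R%:E)%E.

(* Main.v *)
(* Write L = log(1/alpha). As log p(m) ~ pi sqrt(2m/3), both halves concern the
   size of log p_A(n) relative to 2 L sqrt(alpha n).

   Upper bound. Take N such that A has about alpha N elements up to N, put
   n = alpha N^2 and t = L/N, and use p_A(n) <= e^(tn) prod_(a in A) 1/(1-e^(-ta)).
   Here tn = alpha N L; the factors with a <= N contribute at most about
   alpha N L, the worst case being an initial segment of length alpha N; and those
   with a > N contribute O(alpha N / L), because e^(-tN) = alpha.

   Lower bound. Let A contain 1 and omit the intervals (alpha N, N] with N = j!.
   For n = y alpha N^2 there are about 1/alpha choices for the multiplicity of each
   of the alpha N elements of A below alpha N, and about 1/alpha choices for each of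
   y alpha N parts slightly above N. This gives log p_A(n) >= (1 + y) alpha N L up to
   lower order terms, and (1 + y) alpha N >= 2 sqrt(alpha n). When y is not between
   1/(256 L^2) and 1024 L^2, a large interval of distinct parts suffices. *)

Require Import Defs.
From HB Require Import structures.
From mathcomp Require Import all_boot all_order all_algebra.
From mathcomp Require Import all_classical all_reals all_analysis.
From mathcomp Require Import ring lra zify.

Set Implicit Arguments.
Unset Strict Implicit.
Unset Printing Implicit Defensive.

Import Order.TTheory GRing.Theory Num.Theory.
Import numFieldNormedType.Exports.

Local Open Scope classical_set_scope.
Local Open Scope ring_scope.

(** * Sums of inverse squares *)

(** The constant sqrt 6 / pi is the quotient of the coefficients in 2 L sqrt(alpha n) and in log
    p(m) ~ 2 (pi / sqrt 6) sqrt m at m = floor(alpha n). Both directions of the latter are derived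
    from the generating function at e^(-t), whose logarithm is about (pi^2 / 6) / t; this is why the
    sum of the inverse squares is evaluated. Minimising t m + (pi^2 / 6) / t gives the upper
    estimate; the lower one needs the generating function to concentrate near one weight. The two
    halves are asymmetric. Bounding a limit inferior from above takes only infinitely many n, so it
    is enough to look at scales N at which A is thin. The construction must serve every large n,
    also those far from the critical size alpha N^2, which forces the separate ranges of y. The
    estimates are sharp only as alpha tends to 0, but the error functions must be finite on all of
    (0, 1); crude bounds take care of the remaining alpha. *)

Lemma derive_nneg_le (R : realType) (f df : R -> R) (a b : R) :
  a <= b -> (forall x, a <= x <= b -> is_derive x 1 f (df x)) ->
  (forall x, a <= x <= b -> 0 <= df x) -> f a <= f b.
Proof.
move=> ab fdf df0.
have [||c cab] := @MVT_segment R f df a b ab.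
- by move=> x /[!in_itv]/= /andP[/ltW ? /ltW ?]; apply: fdf; apply/andP.
- apply: derivable_within_continuous => x /[!in_itv]/= xab.
  exact: (@ex_derive _ _ _ _ _ _ _ (fdf x xab)).
move: cab; rewrite in_itv /= => cab fab.
by rewrite -subr_ge0 fab mulr_ge0 ?subr_ge0 ?df0.
Qed.

Section Basel.
Variable R : realType.
Implicit Types (x : R) (n k : nat).

Lemma sin_le_id x : 0 <= x -> sin x <= x.
Proof.
move=> x0; rewrite -subr_ge0.
suff : (id - @sin R) 0 <= (id - @sin R) x by rewrite !fctE sin0 subr0.
apply: (@derive_nneg_le R _ (fun y => 1 - cos y)) => // y _.
Qed.

Lemma id_mul_cos_le_sin x : 0 <= x <= pi / 2 -> x * cos x <= sin x.
Proof.
move=> /andP[x0 xpi]; rewrite -subr_ge0.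
suff : (@sin R - id * @cos R) 0 <= (@sin R - id * @cos R) x.
  by rewrite !fctE sin0 mul0r subr0.
apply: (@derive_nneg_le R _ (fun y => y * sin y)) => // y /andP[y0 yx].
  by apply: is_derive_eq; rewrite /GRing.scale /=; ring.
rewrite mulr_ge0 // sin_ge0_pi // y0 /=.
by rewrite (le_trans yx) // (le_trans xpi) // ler_pdivrMr // ler_peMr ?pi_ge0 ?ler1n.
Qed.

Lemma sin2V_half x : sin (x / 2) != 0 -> cos (x / 2) != 0 ->
  (sin x) ^- 2 = ((sin (x / 2)) ^- 2 + (cos (x / 2)) ^- 2) / 4.
Proof.
move=> s0 c0; have {1}-> : x = (x / 2) *+ 2 by rewrite -mulr_natr divfK.
have := cos2Dsin2 (x / 2); rewrite sin_mulr2n.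
set s := sin _ in s0 *; set c := cos _ in c0 * => cs.
have -> : s ^- 2 + c ^- 2 = (c ^+ 2 + s ^+ 2) / (c * s) ^+ 2.
  by field; rewrite c0 s0.
by rewrite cs; field; rewrite s0 c0.
Qed.

Definition odd_angle n k : R := (k.*2.+1)%:R * pi / (2 ^ n.+2)%:R.

Lemma odd_angle_gt0 n k : 0 < odd_angle n k.
Proof. by rewrite !mulr_gt0 ?pi_gt0 ?invr_gt0 ?ltr0n ?expn_gt0. Qed.

Lemma odd_angle_lt n k : (k < 2 ^ n)%N -> odd_angle n k < pi / 2.
Proof.
move=> kn; rewrite /odd_angle ltr_pdivrMr ?ltr0n ?expn_gt0 // expnS natrM.
have -> : pi / 2 * (2%:R * (2 ^ n.+1)%:R) = (2 ^ n.+1)%:R * pi :> R by field.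
by rewrite ltr_pM2r ?pi_gt0 // ltr_nat expnS; lia.
Qed.

(* The identity of [sin2V_half], iterated from the angle [pi / 4]: halving sends
   the odd multiples of pi / 2^(n+2) to those of pi / 2^(n+3), as
   cos (x / 2) = sin (pi / 2 - x / 2). *)
Lemma sum_sin2V n :
  \sum_(k < 2 ^ n) (sin (odd_angle n k)) ^- 2 = (2 * 4 ^ n)%:R.
Proof.
elim: n => [|n IH].
  rewrite big_ord1 /odd_angle mul1r.
  have /(congr1 (fun x => x ^+ 2)) := @tan_piquarter R.
  have := cos2Dsin2 (pi / 4 : R).
  rewrite /tan expr_div_n expr1n.
  have [->|c0] := eqVneq (cos (pi / 4 : R)) 0.
    by rewrite expr0n /= invr0 mulr0 => _ /eqP; rewrite eq_sym oner_eq0.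
  move=> + /divr1_eq => /[swap] -> h.
  have -> : cos (pi / 4) ^+ 2 = 1 / 2 :> R by lra.
  by rewrite div1r invrK.
rewrite [(2 ^ n.+1)%N]expnS mul2n -addnn big_split_ord /=.
(* Reversing the upper half of the range pairs the index i with 2^(n+1) - 1 - i, whose angle is the
   complement of that of i. *)
rewrite [X in _ + X](reindex_inj rev_ord_inj) /= -big_split /=.
rewrite expnS mulnCA natrM -IH mulr_sumr; apply: eq_bigr => i _.
have := @odd_angle_gt0 n i; have := @odd_angle_lt n i (ltn_ord i) => xlt x0.
have half : odd_angle n.+1 i = odd_angle n i / 2.
  rewrite /odd_angle [in LHS]expnS natrM invfM; ring.
have conj : odd_angle n.+1 (2 ^ n + (2 ^ n - i.+1)) = pi / 2 - odd_angle n i / 2.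
  rewrite -half /odd_angle.
  have -> : ((2 ^ n + (2 ^ n - i.+1)).*2.+1)%:R = (2 ^ n.+2)%:R - (i.*2.+1)%:R :> R.
    rewrite -natrB; last by have := ltn_ord i; rewrite !expnS; lia.
    by congr (_%:R); have := ltn_ord i; rewrite !expnS; lia.
  rewrite (expnS 2 n.+2) natrM.
  by field; rewrite pnatr_eq0 -lt0n expn_gt0.
rewrite conj half sinB cos_pihalf sin_pihalf mul0r subr0 mul1r.
have h0 : 0 < odd_angle n i / 2 by lra.
have h1 : odd_angle n i / 2 < pi / 2 by lra.
rewrite (@sin2V_half (odd_angle n i)); first by rewrite [RHS]mulrC divfK // pnatr_eq0.
- by rewrite gt_eqF // sin_gt0_pihalf // h0.
- by rewrite gt_eqF // cos_gt0_pihalf // h1 andbT; lra.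
Qed.

(** On (0, pi/2), x cos x <= sin x <= x gives sin^-2 - 1 = cot^2 <= x^-2 <= sin^-2. The loss of 1
    per term, 2^n in all, is negligible against 2 * 4^n. *)
Lemma sum_odd_angleV_bounds n :
  (2 * 4 ^ n)%:R - (2 ^ n)%:R <= \sum_(k < 2 ^ n) (odd_angle n k) ^- 2 <= (2 * 4 ^ n)%:R.
Proof.
rewrite -sum_sin2V; apply/andP; split; last first.
  apply: ler_sum => i _; have x0 := odd_angle_gt0 n i.
  have xlt := odd_angle_lt (ltn_ord i).
  have s0 : 0 < sin (odd_angle n i) by rewrite sin_gt0_pihalf // x0.
  by rewrite lef_pV2 ?posrE ?exprn_gt0 // ler_pXn2r ?nnegrE ?sin_le_id // ltW.
have {1}-> : (2 ^ n)%:R = \sum_(k < 2 ^ n) (1 : R) by rewrite sumr_const card_ord.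
rewrite -sumrB; apply: ler_sum => i _; have x0 := odd_angle_gt0 n i.
have xlt := odd_angle_lt (ltn_ord i); move: (odd_angle n i) x0 xlt => x x0 xlt.
have s0 : 0 < sin x by rewrite sin_gt0_pihalf // x0.
have -> : (sin x) ^- 2 - 1 = (cos x) ^+ 2 / (sin x) ^+ 2.
  by rewrite cos2sin2 mulrBl mul1r divff // expf_neq0 // gt_eqF.
rewrite ler_pdivrMr ?exprn_gt0 // mulrC ler_pdivlMr ?exprn_gt0 // mulrC -exprMn.
have c0 : 0 <= cos x by rewrite cos_ge0_pihalf //; apply/andP; split; lra.
rewrite ler_pXn2r ?nnegrE ?mulr_ge0 ?(ltW s0) ?(ltW x0) //.
by rewrite id_mul_cos_le_sin // !ltW.
Qed.

Definition inv_squares J : R := \sum_(j < J) (j.+1)%:R ^- 2.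

Lemma inv_squares_nd : {homo inv_squares : m n / (m <= n)%N >-> m <= n}.
Proof.
apply: homo_leq => [x|y x z|i]; [exact: lexx|exact: le_trans|].
by rewrite /inv_squares big_ord_recr /= lerDl invr_ge0 exprn_ge0.
Qed.

Lemma inv_squares_double J :
  inv_squares J.*2 = \sum_(k < J) (k.*2.+1)%:R ^- 2 + inv_squares J / 4.
Proof.
rewrite /inv_squares; elim: J => [|J IH]; first by rewrite !big_ord0 mul0r addr0.
rewrite doubleS !big_ord_recr /= IH.
have -> : (J.*2.+2)%:R = 2 * (J.+1)%:R :> R by rewrite -natrM; congr _%:R; lia.
set S := \sum_(i < J) _; set T := \sum_(i < J) _.
have : (J.*2.+1)%:R != 0 :> R by rewrite pnatr_eq0.
have : (J.+1)%:R != 0 :> R by rewrite pnatr_eq0.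
by move: (J.+1)%:R (J.*2.+1)%:R => a b a0 b0; field; rewrite a0 b0.
Qed.

Lemma sum_odd_bounds n :
  (pi : R) ^+ 2 / 8 - pi ^+ 2 / 16 / (2 ^ n)%:R
  <= \sum_(k < 2 ^ n) (k.*2.+1)%:R ^- 2 <= (pi : R) ^+ 2 / 8.
Proof.
have := sum_odd_angleV_bounds n.
have P0 : 0 < (2 ^ n)%:R :> R by rewrite ltr0n expn_gt0.
have pi0 : 0 < pi :> R := pi_gt0 R.
have E : (4 ^ n)%:R = (2 ^ n)%:R ^+ 2 :> R by rewrite -natrX -expnM mulnC expnM.
have -> : \sum_(k < 2 ^ n) (odd_angle n k) ^- 2 =
    16 * (2 ^ n)%:R ^+ 2 / pi ^+ 2 * \sum_(k < 2 ^ n) (k.*2.+1)%:R ^- 2.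
  rewrite mulr_sumr; apply: eq_bigr => i _; rewrite /odd_angle !expnS !natrM.
  have : (i.*2.+1)%:R != 0 :> R by rewrite pnatr_eq0.
  move: (i.*2.+1)%:R => a a0; move: P0 pi0; move: (2 ^ n)%:R (pi : R) => P p P0 p0.
  by field; rewrite a0 (gt_eqF P0) (gt_eqF p0).
rewrite natrM E; move: (\sum_(k < 2 ^ n) _) => X.
move: P0 pi0; move: (2 ^ n)%:R (pi : R) => P p P0 p0 /andP[lo hi].
have Q0 : 0 < 16 * P ^+ 2 / p ^+ 2 by rewrite divr_gt0 ?mulr_gt0 ?exprn_gt0.
apply/andP; split; rewrite -(ler_pM2l Q0).
  apply: le_trans lo; rewrite le_eqVlt; apply/orP; left; apply/eqP.
  by field; rewrite ?(gt_eqF P0) (gt_eqF p0).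
apply: le_trans hi _; rewrite le_eqVlt; apply/orP; left; apply/eqP.
by field; rewrite ?(gt_eqF P0) (gt_eqF p0).
Qed.

(** Writing S for [inv_squares], S(2P) is the odd part plus S(P) / 4. As S(P) <= S(2P), three
    quarters of S(P) are at most the odd part, hence at most pi^2 / 8. *)
Lemma inv_squares_le J : inv_squares J <= pi ^+ 2 / 6.
Proof.
have h : inv_squares J <= inv_squares (2 ^ J) by apply/inv_squares_nd/ltnW/ltn_expl.
have := inv_squares_double (2 ^ J); have /andP[_] := sum_odd_bounds J.
have : inv_squares (2 ^ J) <= inv_squares (2 ^ J).*2.
  by apply: inv_squares_nd; rewrite -addnn leq_addr.
lra.
Qed.

Lemma inv_squares_ge (e : R) : 0 < e -> exists J, pi ^+ 2 / 6 - e <= inv_squares J.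
Proof.
move=> e0.
(* The error e(n) satisfies e(n+1) <= e(n) / 4 + pi^2 / (16 * 2^n), and the claimed bound is
   preserved because 1/12 + 1/16 <= 1/6. *)
have step n : pi ^+ 2 / 6 - inv_squares (2 ^ n) <= pi ^+ 2 / 3 / (2 ^ n)%:R.
  have p0 : 0 < (pi : R) ^+ 2 by rewrite exprn_gt0 // pi_gt0.
  elim: n => [|n IH].
    have : 0 <= inv_squares (2 ^ 0) by rewrite sumr_ge0 // => i _; rewrite invr_ge0 exprn_ge0.
    by rewrite divr1; lra.
  have := inv_squares_double (2 ^ n); rewrite -mul2n -expnS => ->.
  have /andP[+ _] := sum_odd_bounds n.
  rewrite (expnS 2 n) natrM invfM.
  have i0 : 0 < (2 ^ n)%:R^-1 :> R by rewrite invr_gt0 ltr0n expn_gt0.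
  have : 0 <= (pi : R) ^+ 2 * (2 ^ n)%:R^-1 by rewrite mulr_ge0 // ltW.
  lra.
exists (2 ^ Num.bound (pi ^+ 2 / 3 / e))%N.
have := step (Num.bound (pi ^+ 2 / 3 / e)); set N := Num.bound _.
suff : pi ^+ 2 / 3 / (2 ^ N)%:R <= e by lra.
rewrite ler_pdivrMr ?ltr0n ?expn_gt0 // -ler_pdivrMl // [X in X <= _]mulrC.
have /ltW : pi ^+ 2 / 3 / e < N%:R.
  by rewrite archi_boundP // !divr_ge0 ?exprn_ge0 ?pi_ge0 // ltW.
by move/le_trans; apply; rewrite ler_nat ltnW // ltn_expl.
Qed.

End Basel.

(** * The logarithmic series *)

Lemma mul_geometric_sum (R : pzRingType) (x : R) n :
  (1 - x) * \sum_(j < n) x ^+ j = 1 - x ^+ n.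
Proof. by rewrite -[RHS]opprB subrX1 -mulNr opprB. Qed.

Section LogSeries.
Variable R : realType.
Implicit Types (x : R) (J : nat).

(** The Taylor polynomial of degree J of -ln(1 - x) at 0. *)
Definition log_partial J x : R := \sum_(j < J) x ^+ j.+1 / j.+1%:R.

Lemma log_partialS J x :
  log_partial J.+1 x = log_partial J x + x ^+ J.+1 / J.+1%:R.
Proof. by rewrite /log_partial big_ord_recr. Qed.

Lemma is_derive_monomial (c : R) J x :
  is_derive x 1 (fun y => c * y ^+ J.+1) (c * (J.+1%:R * x ^+ J)).
Proof.
have -> : (fun y => c * y ^+ J.+1) = c *: (@id R) ^+ J.+1.
  by apply/funext => y; rewrite !fctE.
apply: (is_derive_eq (is_deriveZ c (is_deriveX J.+1 (is_derive_id x 1)))).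
by rewrite /GRing.scale /= mulr1.
Qed.

Lemma is_derive_log_partial J x :
  is_derive x 1 (log_partial J) (\sum_(j < J) x ^+ j).
Proof.
elim: J => [|J IH].
  have -> : log_partial 0 = cst 0.
    by apply/funext => y; rewrite /log_partial big_ord0.
  by rewrite big_ord0; exact: is_derive_cst.
have -> : log_partial J.+1 = log_partial J + (fun y => J.+1%:R^-1 * y ^+ J.+1).
  by apply/funext => y; rewrite log_partialS !fctE mulrC.
rewrite big_ord_recr /=; apply: is_deriveD.
apply: (is_derive_eq (is_derive_monomial _ _ _)).
by rewrite mulrA mulVf ?mul1r // pnatr_eq0.
Qed.

Lemma is_derive_ln_onem x : x < 1 ->
  is_derive x 1 (fun y => - ln (1 - y)) (1 - x)^-1.
Proof.
move=> x1; have lnD : is_derive (1 - x) 1 (@ln R) (1 - x)^-1.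
  by apply: is_derive1_ln; rewrite subr_gt0.
have -> : (fun y => - ln (1 - y)) = - (@ln R \o (cst 1 - id)) by [].
have dB : is_derive x 1 (cst 1 - @id R) (- 1).
  by have := is_deriveB (is_derive_cst (1 : R) x 1) (is_derive_id x 1); rewrite sub0r.
have := is_deriveN (@is_derive1_comp _ (@ln R) (cst 1 - id) x _ _ lnD dB).
by rewrite mulrN1 opprK.
Qed.

Lemma log_partial_le J x : 0 <= x < 1 -> log_partial J x <= - ln (1 - x).
Proof.
move=> /andP[x0 x1]; rewrite -subr_ge0.
suff : ((fun y => - ln (1 - y)) - log_partial J) 0
    <= ((fun y => - ln (1 - y)) - log_partial J) x.
  rewrite !fctE subr0 ln1 oppr0 sub0r /log_partial big1 ?oppr0 // => i _.
  by rewrite expr0n mul0r.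
apply: (@derive_nneg_le R _ (fun y => (1 - y)^-1 - \sum_(j < J) y ^+ j)) => //.
  move=> y /andP[y0 yx]; have y1 : y < 1 by apply: le_lt_trans yx x1.
  have := is_derive_ln_onem y1; have := is_derive_log_partial J y => *.
  exact: is_deriveB.
move=> y /andP[y0 yx]; have y1 : 0 < 1 - y by rewrite subr_gt0 (le_lt_trans yx).
rewrite subr_ge0 -div1r ler_pdivlMr // mulrC.
by rewrite mul_geometric_sum gerBl exprn_ge0.
Qed.

(** The remainder at y has derivative y^J / (1 - y), which on [0, x] is at most (J+1) y^J / (1 - x).
    Freezing the denominator at x makes the majorant a monomial in y. *)
Lemma log_partial_ge J x : 0 <= x < 1 ->
  - ln (1 - x) <= log_partial J x + x ^+ J.+1 / (1 - x).
Proof.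
move=> /andP[x0 x1].
have x1' : 0 < 1 - x by rewrite subr_gt0.
pose m y := (1 - x)^-1 * y ^+ J.+1.
suff : (log_partial J + m - (fun y => - ln (1 - y))) 0
    <= (log_partial J + m - (fun y => - ln (1 - y))) x.
  rewrite !fctE subr0 ln1 oppr0 subr0 /log_partial big1; last first.
    by move=> i _; rewrite expr0n mul0r.
  by rewrite /m expr0n /= mulr0 addr0 mulrC subr_ge0.
apply: (@derive_nneg_le R _ (fun y => \sum_(j < J) y ^+ j
    + (1 - x)^-1 * (J.+1%:R * y ^+ J) - (1 - y)^-1)) => //.
  move=> y /andP[y0 yx]; have y1 : y < 1 by apply: le_lt_trans yx x1.
  apply: is_deriveB (is_derive_ln_onem y1).
  exact: is_deriveD (is_derive_log_partial J y) (is_derive_monomial _ _ _).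
move=> y /andP[y0 yx]; have y1 : 0 < 1 - y by rewrite subr_gt0 (le_lt_trans yx).
have -> : \sum_(j < J) y ^+ j = (1 - y ^+ J) / (1 - y).
  apply/(canRL (mulfK _)); first by rewrite gt_eqF.
  by rewrite mulrC mul_geometric_sum.
have E (a b c d : R) : (1 - a) / b + c * d - b^-1 = c * d - a / b by ring.
rewrite E subr_ge0 [X in X <= _]mulrC ler_pM ?invr_ge0 ?exprn_ge0 ?(ltW y1) //.
  by rewrite lef_pV2 ?posrE // lerB.
by rewrite ler_peMl ?exprn_ge0 // ler1n.
Qed.

End LogSeries.

(** * Counting partitions *)

Section PartitionCounts.
Variable R : realType.
Implicit Types (A : set nat) (n : nat).

Lemma geometric_sum_le (x : R) n : 0 <= x < 1 -> \sum_(j < n) x ^+ j <= (1 - x)^-1.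
Proof.
move=> /andP[x0 x1]; have x1' : 0 < 1 - x by rewrite subr_gt0.
rewrite -div1r ler_pdivlMr // mulrC.
by rewrite mul_geometric_sum gerBl exprn_ge0.
Qed.

Lemma expRN_itv (t : R) k : 0 < t -> (0 < k)%N -> 0 <= expR (- (t * k%:R)) < 1.
Proof. by move=> t0 k0; rewrite expR_ge0 expR_lt1 oppr_lt0 mulr_gt0 ?ltr0n. Qed.

(** Each partition of n has weight e^(-tn). Dropping the condition on the sum leaves all
    multiplicity functions supported on A, and their total weight is a product of truncated
    geometric series, with the factor 1 outside A. *)
Lemma num_partitions_chernoff A n (t : R) : all_positive A -> 0 < t ->
  (num_partitions A n)%:R <=
  expR (t * n%:R) * \prod_(i < n.+1 | val i \in A) (1 - expR (- (t * i%:R)))^-1.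
Proof.
move=> Apos t0.
rewrite -ler_pdivrMl ?expR_gt0 // -expRN.
pose F (i j : 'I_n.+1) := expR (- (t * i%:R)) ^+ j : R.
pose Q (i : 'I_n.+1) := [pred j : 'I_n.+1 | (0 < j)%N ==> (val i \in A)].
have -> : expR (- (t * n%:R)) * (num_partitions A n)%:R
    = \sum_(m in partitions A n) \prod_i F i (m i).
  rewrite mulr_natr -sumr_const; apply: eq_bigr => m.
  rewrite inE => /andP[_ /eqP mn].
  rewrite -[in LHS]mn natr_sum mulr_sumr -sumrN expR_sum; apply: eq_bigr => i _.
  by rewrite /F -expRM_natl natrM mulrCA mulrN.
apply: (@le_trans _ _ (\sum_(m in family Q) \prod_i F i (m i))).
  rewrite [leRHS](bigID [in partitions A n]) /= [leLHS](eq_bigl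
     (fun m => (m \in family Q) && (m \in partitions A n))); last first.
    move=> m /=; rewrite [RHS]andbC; case: (boolP (m \in partitions A n)) => //=.
    rewrite inE => /andP[/forallP h _]; symmetry; apply/familyP => i; rewrite inE; exact: h.
  by rewrite lerDl sumr_ge0 // => m _; rewrite prodr_ge0 // => i _; rewrite exprn_ge0 ?expR_ge0.
rewrite -bigA_distr_big_dep [leRHS]big_mkcond /=.
apply: ler_prod => i _; rewrite sumr_ge0 /=; last by move=> j _; rewrite exprn_ge0 ?expR_ge0.
case: ifPn => iA.
  rewrite (eq_bigl xpredT); last by move=> j; rewrite /Q /= implybT.
  apply: geometric_sum_le; apply: expRN_itv => //.
  by apply: Apos; move: iA; rewrite in_setE.
rewrite (big_pred1 ord0) /F ?expr0 // => j.
by rewrite /Q /= implybF -leqNgt leqn0.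
Qed.

End PartitionCounts.

(* The part 1 absorbs what is missing to reach the sum n. *)
Lemma card_le_num_partitions (A : set nat) n (I X : finType) (D : {set X})
    (s : I -> nat) (f : X -> I -> nat) :
  A 1%N -> injective s -> (forall i, 1 < s i)%N -> (forall i, A (s i)) ->
  {in D, forall x, \sum_i f x i * s i <= n}%N ->
  {in D &, forall x y, f x =1 f y -> x = y} ->
  (#|D| <= num_partitions A n)%N.
Proof.
move=> A1 sI s1 sA sumn fI.
pose W x := (\sum_i f x i * s i)%N.
(* Multiplicity of the part k in the partition attached to x. The sum has at most one term since [s]
   is injective, and none for k = 1 since every [s i] exceeds 1. *)
pose mul x (k : nat) := (\sum_(i | s i == k) f x i + (k == 1) * (n - W x))%N.
have mul_s x i : mul x (s i) = f x i.
  rewrite /mul (gtn_eqF (s1 i)) mul0n addn0 (big_pred1 i) // => j /=.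
  by rewrite (inj_eq sI).
have mul_sum x : x \in D -> (\sum_(k < n.+1) mul x k * k = n)%N.
  move=> xD; under eq_bigr do rewrite mulnDl.
  rewrite big_split /=.
  have -> : (\sum_(k < n.+1) (\sum_(i | s i == k) f x i) * k = W x)%N.
    rewrite (eq_bigr (fun k : 'I_n.+1 => \sum_(i | s i == k) f x i * k)%N); last first.
      by move=> k _; rewrite big_distrl.
    rewrite /W.
    rewrite (exchange_big_dep xpredT) //=; apply: eq_bigr => i _.
    have [fi0|fi0] := posnP (f x i); first by rewrite fi0 mul0n big1.
    have sin : (s i < n.+1)%N.
      rewrite ltnS; apply: leq_trans (sumn x xD).
      by rewrite (bigD1 i) //= (leq_trans _ (leq_addr _ _)) // leq_pmull.
    rewrite (big_pred1 (Ordinal sin)) // => k; rewrite -val_eqE /=; exact: eq_sym.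
  have := sumn x xD; rewrite -/(W x) => Wn.
  (* For n = 0 the part 1 is not among the indices k < n + 1, but then nothing has to be filled
     up. *)
  case: n Wn => [|n'] Wn in sumn mul mul_s *.
    by rewrite big1 ?addn0; [apply/eqP; rewrite -leqn0|move=> k _; rewrite sub0n muln0].
  rewrite (bigD1 (inord 1)) //= inordK // mul1n muln1 big1 ?addn0 ?subnKC //.
  by move=> k; rewrite -val_eqE /= inordK // => /negPf ->.
have mul_le x (k : 'I_n.+1) : x \in D -> (mul x k <= n)%N.
  move=> xD; rewrite -[leqRHS](mul_sum x xD) (bigD1 k) //=.
  have [k0|k0] := posnP k; last by rewrite (leq_trans _ (leq_addr _ _)) // leq_pmulr.
  rewrite /mul k0 mul0n addn0 big_pred0 // => i; apply/negbTE.
  by rewrite -lt0n (ltn_trans _ (s1 i)).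
pose F x := [ffun k : 'I_n.+1 => inord (mul x k) : 'I_n.+1].
have FE x k : x \in D -> val (F x k) = mul x k.
  by move=> xD; rewrite ffunE /= inordK // ltnS mul_le.
rewrite -(card_in_imset (f := F) (D := D)).
  apply: subset_leq_card; apply/fintype.subsetP => _ /imsetP[x xD ->].
  rewrite inE; apply/andP; split; last first.
    by apply/eqP; rewrite -[RHS](mul_sum x xD); apply: eq_bigr => k _; rewrite FE.
  apply/forallP => k; rewrite FE //; apply/implyP; rewrite in_setE /mul /=.
  have [->//|k1] := eqVneq (k : nat) 1%N.
  rewrite ?(negPf k1) mul0n addn0; case: (pickP (fun i => s i == k)) => [i /eqP <- //|no].
  by rewrite big_pred0.
move=> x y xD yD FF; apply: fI => // i.
have sin z : z \in D -> (0 < f z i)%N -> (s i < n.+1)%N.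
  move=> zD fi0; rewrite ltnS; apply: leq_trans (sumn z zD).
  by rewrite (bigD1 i) //= (leq_trans _ (leq_addr _ _)) // leq_pmull.
have key : (s i < n.+1)%N -> f x i = f y i.
  by move=> si; have := FE x (Ordinal si) xD; rewrite FF FE //= !mul_s.
have [fx|fx] := posnP (f x i); last by apply: key; exact: sin fx.
have [fy|fy] := posnP (f y i); last by apply: key; exact: sin fy.
by rewrite fx fy.
Qed.

(* Each part in (P, P + r] gets a multiplicity less than q, and one part is chosen
   from each of j consecutive intervals of length b above Q. *)
Lemma num_partitions_slots (A : set nat) n (P Q r q j b : nat) :
  A 1%N -> (0 < P)%N -> (0 < q)%N ->
  (forall k, P < k <= P + r -> A k)%N -> (forall k, Q < k <= Q + j * b -> A k)%N ->
  (P + r <= Q)%N -> (r * q * (P + r) + j * (Q + j * b) <= n)%N ->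
  (q ^ r * b ^ j <= num_partitions A n)%N.
Proof.
move=> A1 P0 q0 AP AQ PQ szn.
pose s (i : 'I_r + 'I_j * 'I_b) : nat :=
  match i with inl i => P + i.+1 | inr (u, c) => Q + (u * b + c).+1 end%N.
pose f (x : {ffun 'I_r -> 'I_q} * {ffun 'I_j -> 'I_b}) (i : 'I_r + 'I_j * 'I_b) : nat :=
  match i with inl i => x.1 i | inr (u, c) => x.2 u == c end.
have ub (u : 'I_j) (c : 'I_b) : (u * b + c < j * b)%N.
  rewrite (@leq_trans (u.+1 * b)) ?leq_mul2r ?ltn_ord ?orbT //.
  by rewrite mulSn addnC ltn_add2r.
have := @card_le_num_partitions A n _ _ [set: _]%SET s f A1.
rewrite cardsT card_prod !card_ffun !card_ord; apply.
- move=> [i|[u c]] [i'|[u' c']] /= /eqP.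
  + by rewrite eqn_add2l eqSS => /eqP/val_inj ->.
  + move=> /eqP E; exfalso; have := ltn_ord i; move: E; lia.
  + move=> /eqP E; exfalso; have := ltn_ord i'; move: E; lia.
  + rewrite eqn_add2l eqSS => /eqP E.
    have b0 : (0 < b)%N by case: (b) c {E} => // -[].
    have /(congr1 (fun k => k %/ b)%N) := E; have /(congr1 (fun k => k %% b)%N) := E.
    rewrite !modnMDl !modn_small // !divnMDl // !divn_small // !addn0.
    by move=> /val_inj -> /val_inj ->.
- by move=> [i|[u c]] /=; lia.
- move=> [i|[u c]] /=; first by apply: AP; have := ltn_ord i; lia.
  by apply: AQ; have := ub u c; lia.
- move=> [g h] _; rewrite big_sumType /=; apply: leq_trans szn; apply: leq_add.
    apply: (@leq_trans (\sum_(i < r) q * (P + r))).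
      by apply: leq_sum => i _; apply: leq_mul; [exact: ltnW|have := ltn_ord i; lia].
    by rewrite sum_nat_const card_ord mulnA.
  rewrite (eq_bigr (fun p => (h p.1 == p.2) * (Q + (p.1 * b + p.2).+1))%N); last first.
    by move=> [u c].
  rewrite -(pair_bigA _ (fun u c => (h u == c) * (Q + (u * b + c).+1)))%N /=.
  apply: (@leq_trans (\sum_(u < j) (Q + j * b))).
    apply: leq_sum => u _; rewrite (bigD1 (h u)) //= eqxx mul1n big1 ?addn0.
      by rewrite leq_add2l; exact: ub.
    by move=> c /negPf; rewrite eq_sym => ->.
  by rewrite sum_nat_const card_ord.
- move=> [g h] [g' h'] _ _ E; congr pair; apply/ffunP => i.
    by apply: val_inj; exact: E (inl i).
  by have := E (inr (i, h i)) => /=; rewrite eqxx; case: eqP.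
Qed.

(** * Generating function estimates *)

Section PartitionAsymptotics.
Variable R : realType.
Implicit Types (t s : R) (J K Y n m : nat).

Definition zeta2 : R := pi ^+ 2 / 6.

Lemma zeta2_gt0 : 0 < zeta2.
Proof. by rewrite divr_gt0 // exprn_gt0 // pi_gt0. Qed.

Lemma expR_geo_le s : 0 < s -> expR (- s) / (1 - expR (- s)) <= s^-1.
Proof.
move=> s0; have x1 : 0 < 1 - expR (- s) by rewrite subr_gt0 expR_lt1 oppr_lt0.
rewrite ler_pdivrMr // mulrC ler_pdivlMr // lerBrDr.
rewrite -[X in _ + X]mulr1 -mulrDr expRN -ler_pdivlMl ?invr_gt0 ?expR_gt0 // invrK mulr1.
by rewrite addrC expR_ge1Dx.
Qed.

Lemma expR_geo_ge s : 0 < s -> s^-1 - 1 <= expR (- s) / (1 - expR (- s)).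
Proof.
move=> s0; have x1 : 0 < 1 - expR (- s) by rewrite subr_gt0 expR_lt1 oppr_lt0.
have -> : expR (- s) / (1 - expR (- s)) = (1 - expR (- s))^-1 - 1.
  by rewrite -[X in _ = _ - X](divff (lt0r_neq0 x1)) -[X in _ = X - _]div1r -mulrBl;
    congr (_ / _); ring.
rewrite lerD2r lef_pV2 ?posrE //.
by have := expR_ge1Dx (- s); lra.
Qed.

Lemma expRN_pow_small t (C e : R) : 0 < t -> 0 <= C -> 0 < e ->
  exists n, C * expR (- t) ^+ n <= e.
Proof.
move=> t0 C0 e0; exists (Num.bound (C / (t * e))).
have := @archi_boundP R (C / (t * e)); set N := Num.bound _.
move=> /(_ (divr_ge0 C0 (ltW (mulr_gt0 t0 e0)))).
rewrite ltr_pdivrMr ?mulr_gt0 // => CN.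
rewrite -expRM_natl mulrN expRN ler_pdivrMr ?expR_gt0 //.
apply: le_trans (ltW CN) _; rewrite mulrA mulrC ler_pM2l //.
by apply: le_trans (expR_ge1Dx _); rewrite lerDr.
Qed.

(** Logarithm of the factor that the part k contributes to the generating function at e^(-t). *)
Definition log_factor t k : R := - ln (1 - expR (- (t * k%:R))).

Lemma expR_log_factor t k : 0 < t -> (0 < k)%N ->
  expR (log_factor t k) = (1 - expR (- (t * k%:R)))^-1.
Proof.
move=> t0 k0; have /andP[_ x1] := expRN_itv t0 k0.
by rewrite /log_factor expRN lnK // posrE subr_gt0.
Qed.

Lemma log_factor_ge0 t k : 0 < t -> (0 < k)%N -> 0 <= log_factor t k.
Proof.
by move=> t0 k0; rewrite oppr_ge0 ln_le0 // gerBl expR_ge0.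
Qed.

Lemma sum_log_partial t J K p :
  \sum_(k < K) log_partial J (expR (- (t * (k + p)%:R))) =
  \sum_(j < J) (j.+1%:R)^-1 * \sum_(k < K) expR (- (t * j.+1%:R)) ^+ (k + p).
Proof.
rewrite /log_partial exchange_big /=; apply: eq_bigr => j _.
rewrite mulr_sumr; apply: eq_bigr => k _; rewrite mulrC -!expRM_natl.
by congr (_ * expR _); ring.
Qed.

(** Expanding the logarithms and summing over k before j gives sum_j (1/j) / (e^(tj) - 1) <= sum_j 1
    / (t j^2). The degree J is taken so large, depending on K, that the K Taylor remainders add up
    to at most e. *)
Lemma sum_log_factor_le t K : 0 < t ->
  \sum_(k < K) log_factor t k.+1 <= zeta2 / t.
Proof.
move=> t0; apply/ler_addgt0Pr => e e0.
have /andP[x0 x1] := expRN_itv t0 (ltn0Sn 0); rewrite mulr1 in x0 x1.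
have x1' : 0 < 1 - expR (- t) by rewrite subr_gt0.
have [|J hJ] := @expRN_pow_small t (K%:R / (1 - expR (- t))) e t0 _ e0.
  by rewrite divr_ge0 // ltW.
apply: (@le_trans _ _ (\sum_(k < K) (log_partial J (expR (- (t * (k + 1)%:R)))
    + expR (- t) ^+ J / (1 - expR (- t))))).
  apply: ler_sum => k _; rewrite /log_factor -addn1.
  have kk : (0 < k + 1)%N by rewrite addn1.
  apply: le_trans (log_partial_ge J (expRN_itv t0 kk)) _.
  rewrite lerD2l.
  have xk : expR (- (t * (k + 1)%:R)) <= expR (- t).
    by rewrite ler_expR lerN2 ler_peMr ?(ltW t0) // ler1n.
  have /andP[xk0 xk1] := expRN_itv t0 kk.
  rewrite ler_pM ?invr_ge0 ?exprn_ge0 ?subr_ge0 ?(ltW xk1) //.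
    apply: (@le_trans _ _ (expR (- t) ^+ J.+1)).
      by rewrite ler_pXn2r ?nnegrE ?expR_ge0.
    by rewrite exprS ler_piMl ?exprn_ge0 // ltW.
  by rewrite lef_pV2 ?posrE ?subr_gt0 // lerD2l lerN2.
rewrite big_split /= sumr_const card_ord -mulr_natl.
apply: lerD; last by rewrite mulrCA mulrC.
rewrite sum_log_partial.
apply: (@le_trans _ _ (inv_squares R J / t)); last first.
  by rewrite ler_pM2r ?invr_gt0 // inv_squares_le.
rewrite /inv_squares mulr_suml; apply: ler_sum => j _.
have j0 : 0 < j.+1%:R :> R by rewrite ltr0n.
have -> : j.+1%:R ^- 2 / t = j.+1%:R^-1 * (t * j.+1%:R)^-1.
  by rewrite !invfM; ring.
rewrite ler_pM2l ?invr_gt0 //.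
apply: le_trans (expR_geo_le (mulr_gt0 t0 j0)).
under eq_bigr do rewrite addn1 exprS.
by rewrite -mulr_sumr ler_pM2l ?expR_gt0 // geometric_sum_le // expRN_itv.
Qed.

Lemma num_partitions_le_expR (A : set nat) n t : all_positive A -> 0 < t ->
  (num_partitions A n)%:R <= expR (t * n%:R + \sum_(i < n.+1 | val i \in A) log_factor t i).
Proof.
move=> Apos t0; rewrite expRD expR_sum.
rewrite (eq_bigr (fun i : 'I_n.+1 => (1 - expR (- (t * i%:R)))^-1)).
  exact: num_partitions_chernoff.
by move=> i; rewrite in_setE => iA; rewrite expR_log_factor // Apos.
Qed.

Lemma sum_log_factor_sub (A : set nat) n t : all_positive A -> 0 < t ->
  \sum_(i < n.+1 | val i \in A) log_factor t i <= \sum_(i < n) log_factor t i.+1.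
Proof.
move=> Apos t0; rewrite big_mkcond big_ord_recl /=.
rewrite ifN ?add0r; last by rewrite notin_setE => /Apos.
by apply: ler_sum => i _; case: ifP => // _; rewrite log_factor_ge0.
Qed.

(** The choice t = sqrt([zeta2] / n) minimises t n + [zeta2] / t, with minimum 2 sqrt([zeta2] n). *)
Lemma num_partitions_le (A : set nat) n : all_positive A -> (0 < n)%N ->
  (num_partitions A n)%:R <= expR (2 * pi / Num.sqrt 6 * Num.sqrt n%:R) :> R.
Proof.
move=> Apos n0; have n0' : 0 < n%:R :> R by rewrite ltr0n.
pose t : R := pi / Num.sqrt 6 / Num.sqrt n%:R.
have s6 : 0 < Num.sqrt 6 :> R by rewrite sqrtr_gt0.
have sn : 0 < Num.sqrt n%:R :> R by rewrite sqrtr_gt0.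
have p0 := pi_gt0 R.
have t0 : 0 < t by rewrite !divr_gt0.
apply: le_trans (num_partitions_le_expR n Apos t0) _.
rewrite ler_expR.
have := le_trans (sum_log_factor_sub n Apos t0) (sum_log_factor_le n t0).
rewrite -(lerD2l (t * n%:R)) => /le_trans; apply.
have -> : zeta2 = pi ^+ 2 / Num.sqrt 6 ^+ 2 by rewrite sqr_sqrtr.
rewrite -[in t * _](@sqr_sqrtr _ n%:R) // /t.
move: (Num.sqrt 6) (Num.sqrt n%:R) (pi : R) s6 sn p0 => a b p a0 b0 p0.
rewrite le_eqVlt; apply/orP; left; apply/eqP; field.
by rewrite !gt_eqF.
Qed.

(* Parts start at 2: the part 1 is kept for filling up, see [card_weight_le]. *)
Definition weight K Y (f : {ffun 'I_K -> 'I_Y}) : nat := (\sum_i f i * i.+2)%N.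

(** Generating function at e^(-t) of the partitions into parts 2, ..., K + 1 with multiplicities
    below Y. Being a finite sum, it can be split according to the weight. *)
Definition weight_sum K Y t : R := \sum_(f : {ffun 'I_K -> 'I_Y}) expR (- (t * (weight f)%:R)).

Lemma weight_sum_prod K Y t :
  weight_sum K Y t = \prod_(i < K) \sum_(j < Y) expR (- (t * i.+2%:R)) ^+ j.
Proof.
rewrite /weight_sum bigA_distr_bigA /=; apply: eq_bigr => f _.
rewrite /weight natr_sum mulr_sumr -sumrN expR_sum; apply: eq_bigr => i _.
by rewrite -expRM_natl natrM mulrCA mulrN.
Qed.

Lemma weight_sum_le K Y t : 0 < t -> weight_sum K Y t <= expR (zeta2 / t).
Proof.
move=> t0; rewrite weight_sum_prod.
apply: (@le_trans _ _ (\prod_(i < K) expR (log_factor t i.+2))).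
  apply: ler_prod => i _; rewrite sumr_ge0 /=; last by move=> *; rewrite exprn_ge0 ?expR_ge0.
  by rewrite expR_log_factor // geometric_sum_le // expRN_itv.
rewrite -expR_sum ler_expR; apply: le_trans (sum_log_factor_le K.+1 t0).
by rewrite big_ord_recl /= lerDr log_factor_ge0.
Qed.

(** Only J terms of each logarithm are kept. For each j the geometric sum over the parts loses at
    most 1 against 1 / (tj) and at most 1 for the missing part 1, hence 2 J; the tails beyond K lose
    at most 1 in all. *)
Lemma sum_log_factor_ge t J : 0 < t -> exists K,
  inv_squares R J / t - 2 * J%:R - 1 <= \sum_(i < K) log_factor t i.+2.
Proof.
move=> t0.
have /andP[x0 x1] := expRN_itv t0 (ltn0Sn 0); rewrite mulr1 in x0 x1.
have x1' : 0 < 1 - expR (- t) by rewrite subr_gt0.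
have [||K hK] := @expRN_pow_small t (J%:R / (1 - expR (- t))) 1 t0 => //.
  by rewrite divr_ge0 // ltW.
exists K; apply: (@le_trans _ _ (\sum_(k < K) log_partial J (expR (- (t * (k + 2)%:R)))));
  last first.
  apply: ler_sum => k _; rewrite -(addn2 k); apply: log_partial_le.
  by rewrite expRN_itv // addn2.
rewrite sum_log_partial.
apply: (@le_trans _ _ (\sum_(j < J) (j.+1%:R ^- 2 / t - 2 - expR (- t) ^+ K / (1 - expR (-
  t))))).
  rewrite !sumrB -mulr_suml !sumr_const !card_ord -(mulr_natr 2) lerB // .
  by rewrite -mulr_natl mulrCA mulrC.
apply: ler_sum => j _.
have j0 : 0 < j.+1%:R :> R by rewrite ltr0n.
have /andP[y0 y1] := expRN_itv t0 (ltn0Sn j).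
have y1' : 0 < 1 - expR (- (t * j.+1%:R)) by rewrite subr_gt0.
have yx : expR (- (t * j.+1%:R)) <= expR (- t).
  by rewrite ler_expR lerN2 ler_peMr ?(ltW t0) // ler1n.
have := expR_geo_ge (mulr_gt0 t0 j0).
move: (expR (- (t * j.+1%:R))) (expR (- t)) y0 y1 y1' yx x0 x1 x1' => y x y0 y1 y1' yx x0 x1
  x1' hy.
have -> : \sum_(k < K) y ^+ (k + 2) = y / (1 - y) - y - y ^+ 2 * y ^+ K / (1 - y).
  under eq_bigr do rewrite exprD mulrC.
  rewrite -mulr_sumr; apply: (mulIf (lt0r_neq0 y1')).
  rewrite -[LHS]mulrA [_ * (1 - y)]mulrC mul_geometric_sum; move: (y ^+ K) => Y; field; lra.
have d1 : y ^+ 2 * y ^+ K / (1 - y) <= x ^+ K / (1 - x).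
  rewrite ler_pM ?invr_ge0 ?mulr_ge0 ?exprn_ge0 ?(ltW y1') //.
    apply: (@le_trans _ _ (y ^+ K)).
      by rewrite ler_piMl ?exprn_ge0 // exprn_ile1 // ltW.
    by rewrite lerXn2r ?nnegrE.
  by rewrite lef_pV2 ?posrE // lerD2l lerN2.
have -> : j.+1%:R ^- 2 / t = j.+1%:R^-1 * (t * j.+1%:R)^-1.
  by rewrite !invfM; ring.
have i1 : j.+1%:R^-1 <= 1 :> R by rewrite invf_le1 // ler1n.
have i0 : 0 < j.+1%:R^-1 :> R by rewrite invr_gt0.
move: (j.+1%:R^-1) ((t * j.+1%:R)^-1) i1 i0 hy => i T i1 i0 hy.
have q0 : 0 <= x ^+ K / (1 - x) by rewrite divr_ge0 ?exprn_ge0 // ltW.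
apply: (@le_trans _ _ (i * (T - 2 - x ^+ K / (1 - x)))); last first.
  rewrite ler_pM2l //; lra.
move: q0; set Q := x ^+ K / _ => q0; nra.
Qed.

(** Once K is fixed, cutting the multiplicities at Y multiplies each factor by at least 1 - z, where
    K z <= 1/2. By Bernoulli's inequality the product keeps at least 1/2 >= e^(-1), which accounts
    for one more unit in the exponent. *)
Lemma weight_sum_ge t J : 0 < t -> exists K Y,
  expR (inv_squares R J / t - 2 * J%:R - 2) <= weight_sum K Y t.
Proof.
move=> t0; have [K hK] := sum_log_factor_ge J t0.
have [||Y hY] := @expRN_pow_small t K%:R (1 / 2) t0 => //.
exists K, Y; rewrite weight_sum_prod.
have /andP[x0 x1] := expRN_itv t0 (ltn0Sn 0); rewrite mulr1 in x0 x1.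
pose z := expR (- t) ^+ Y.
have z0 : 0 <= z by rewrite exprn_ge0.
have z1 : z <= 1 by rewrite exprn_ile1 // ltW.
apply: (@le_trans _ _ (\prod_(i < K) (expR (log_factor t i.+2) * (1 - z)))); last first.
  apply: ler_prod => i _; rewrite mulr_ge0 ?expR_ge0 ?subr_ge0 //=.
  rewrite expR_log_factor //; have /andP[y0 y1] := expRN_itv t0 (ltn0Sn i.+1).
  have yx : expR (- (t * i.+2%:R)) <= expR (- t).
    by rewrite ler_expR lerN2 ler_peMr ?(ltW t0) // ler1n.
  rewrite mulrC ler_pdivrMr ?subr_gt0 // [leRHS]mulrC.
  by rewrite mul_geometric_sum lerD2l lerN2 lerXn2r ?nnegrE ?expR_ge0.
rewrite big_split /= -expR_sum prodr_const card_ord.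
apply: (@le_trans _ _ (expR (\sum_(i < K) log_factor t i.+2) * expR (-1))).
  by rewrite -expRD ler_expR; lra.
rewrite ler_pM2l ?expR_gt0 //.
have bern : 1 - K%:R * z <= (1 - z) ^+ K.
  clear hK hY; elim: K => [|K IH]; first by rewrite mul0r subr0.
  rewrite exprS; apply: (@le_trans _ _ ((1 - z) * (1 - K%:R * z))).
    have : 0 <= K%:R * z * z by rewrite !mulr_ge0.
    by rewrite -natr1; lra.
  by rewrite ler_wpM2l // subr_ge0.
apply: le_trans bern.
have : expR (-1) <= 1 / 2 :> R.
  rewrite expRN div1r lef_pV2 ?posrE ?expR_gt0 //.
  by have := expR_ge1Dx (1 : R); lra.
rewrite -/z in hY; lra.
Qed.

End PartitionAsymptotics.

(** * Lower bound for the partition function *)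

Section PartitionLowerBound.
Variable R : realType.

Lemma card_weight_le K Y m :
  (#|[set f : {ffun 'I_K -> 'I_Y} | (weight f <= m)%N]%SET| <= partition_number m)%N.
Proof.
apply: (@card_le_num_partitions _ m 'I_K {ffun 'I_K -> 'I_Y} _ (fun i => i.+2)
  (fun f i => val (f i))) => //.
- by move=> i j /eqP; rewrite !eqSS => /eqP/val_inj.
- by move=> f; rewrite inE.
- by move=> f g _ _ fg; apply/ffunP => i; apply: val_inj; exact: fg.
Qed.

(* The parts of [weight_sum K Y t] with [t w < (1 - d) s] or [w > m] are
   negligible, by tilting [t] to [(1 + h) t] and [(1 - h) t] respectively. *)
Lemma partition_number_ge_tilted (d s : R) J m :
  0 < d -> d <= 1 -> 0 < s -> m%:R = (1 + d) * s ^+ 2 / zeta2 R ->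
  zeta2 R * (1 - d ^+ 2 / 16) <= inv_squares R J ->
  2 * J%:R + 4 <= s * d ^+ 2 / 16 ->
  expR (s * (2 - d - d ^+ 2 / 8)) <= (partition_number m)%:R.
Proof.
move=> d0 d1 s0 mE HJ Js.
have z0 := zeta2_gt0 R; move: (zeta2 R) z0 mE HJ (@weight_sum_le R) => z z0 mE HJ Wle.
(* At this t the generating function is about e^s, and the weights w concentrate at t w close to s,
   inside the window from (1 - d) s to t m = (1 + d) s. A tilt by h multiplies the exponent s of
   either tail by at most 1 - h d + 2 h^2; h = d / 4 minimises this, with value 1 - d^2 / 8. *)
pose t := z / s; pose h := d / 4.
have t0 : 0 < t by rewrite divr_gt0.
have tm : t * m%:R = (1 + d) * s by rewrite mE /t; field; rewrite !gt_eqF.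
have zt : z / t = s by rewrite /t; field; rewrite !gt_eqF.
have [K [Y lo]] := weight_sum_ge J t0.
(* Each tail will be at most e^(s (1 - d^2 / 8)); the factor 4 <= e^2 leaves twice that amount for
   the middle range. *)
have {}lo : expR (s * (1 - d ^+ 2 / 8)) * 4 <= weight_sum K Y t.
  apply: le_trans lo.
  apply: (@le_trans _ _ (expR (s * (1 - d ^+ 2 / 8)) * expR (2))).
    rewrite ler_pM2l ?expR_gt0 //.
    have e1 := expR_ge1Dx (1 : R).
    have -> : 2 = 1 + 1 :> R by []. rewrite expRD; nra.
  rewrite -expRD ler_expR.
  have : s * (1 - d ^+ 2 / 16) <= inv_squares R J / t.
    by rewrite -[s in s * _]zt mulrAC ler_pM2r ?invr_gt0.
  lra.
pose E (f : {ffun 'I_K -> 'I_Y}) := expR (- (t * (weight f)%:R)).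
pose small := [pred f : {ffun 'I_K -> 'I_Y} | t * (weight f)%:R < (1 - d) * s].
pose large := [pred f : {ffun 'I_K -> 'I_Y} | (m < weight f)%N].
have tilt (u c : R) (P : pred {ffun 'I_K -> 'I_Y}) : 0 < u ->
    (forall f, P f -> u * (weight f)%:R <= t * (weight f)%:R + c) ->
    \sum_(f | P f) E f <= expR (c + z / u).
  move=> u0 Pu; rewrite expRD.
  apply: (@le_trans _ _ (expR c * \sum_(f | P f) expR (- (u * (weight f)%:R)))).
    rewrite mulr_sumr; apply: ler_sum => f Pf; rewrite -expRD ler_expR.
    have := Pu f Pf; lra.
  rewrite ler_pM2l ?expR_gt0 //; apply: le_trans (Wle K Y u u0).
  rewrite /weight_sum [leRHS](bigID P) /= lerDl sumr_ge0 // => f _; exact: expR_ge0.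
have hd : 0 < h <= 1 / 4 by rewrite /h; lra.
have large_le : \sum_(f | large f) E f <= expR (s * (1 - d ^+ 2 / 8)).
  apply: le_trans (tilt ((1 - h) * t) (- (h * ((1 + d) * s))) _ _ _) _.
  - by rewrite mulr_gt0 //; lra.
  - move=> f /=; rewrite -(ltr_nat R) => /ltW; rewrite -(ler_pM2l t0) tm.
    have h0 : 0 < h by lra.
    by rewrite -(ler_pM2l h0); lra.
  - rewrite ler_expR (_ : z / ((1 - h) * t) = (1 - h)^-1 * s); last by rewrite invfM mulrCA zt.
    have -> : s * (1 - d ^+ 2 / 8) = - (h * ((1 + d) * s)) + (1 + h + 2 * h ^+ 2) * s.
      by rewrite /h; field.
    rewrite lerD2l ler_pM2r // -div1r ler_pdivrMr; last by lra.
    have : 0 <= h ^+ 2 * (1 - 2 * h) by rewrite mulr_ge0 ?exprn_ge0; lra.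
    lra.
have small_le : \sum_(f | small f) E f <= expR (s * (1 - d ^+ 2 / 8)).
  apply: le_trans (tilt ((1 + h) * t) (h * ((1 - d) * s)) _ _ _) _.
  - by rewrite mulr_gt0 //; lra.
  - move=> f /= /ltW; have h0 : 0 < h by lra.
    by rewrite -(ler_pM2l h0); lra.
  - rewrite ler_expR (_ : z / ((1 + h) * t) = (1 + h)^-1 * s); last by rewrite invfM mulrCA zt.
    apply: (@le_trans _ _ (h * ((1 - d) * s) + (1 - h + h ^+ 2) * s)).
      rewrite lerD2l ler_pM2r // -div1r ler_pdivrMr; last by lra.
      have : 0 <= h ^+ 3 by rewrite exprn_ge0; lra.
      lra.
    have : 0 <= d ^+ 2 * s by rewrite mulr_ge0 ?exprn_ge0 // ltW.
    by rewrite /h; lra.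
(* Every term of the middle range is at most e^(-(1 - d) s), which turns a lower bound for the sum
   into one for the number of terms. *)
have mid_le : \sum_(f | ~~ small f && ~~ large f) E f
    <= (partition_number m)%:R * expR (- ((1 - d) * s)).
  apply: (@le_trans _ _ (\sum_(f in [set f : {ffun 'I_K -> 'I_Y} | (weight f <= m)%N]%SET)
      expR (- ((1 - d) * s)))).
    rewrite [leLHS]big_mkcond [leRHS]big_mkcond /=; apply: ler_sum => f _.
    rewrite inE -leqNgt -leNgt; case: (weight f <= m)%N; last by rewrite andbF.
    by rewrite andbT; case: ifP => sf; rewrite ?expR_ge0 // ler_expR lerN2.
  by rewrite sumr_const -[leLHS]mulr_natl ler_wpM2r ?expR_ge0 // ler_nat card_weight_le.
have split_le : weight_sum K Y t <= \sum_(f | small f) E f + \sum_(f | large f) E f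
   + \sum_(f | ~~ small f && ~~ large f) E f.
  rewrite /weight_sum [leLHS](bigID small) /= -addrA lerD2l.
  rewrite [leLHS](bigID large) /= lerD2r.
  rewrite [leLHS]big_mkcond [leRHS]big_mkcond /=; apply: ler_sum => f _.
  by case: ifP => [/andP[_ ->]//|_]; case: ifP => // _; exact: expR_ge0.
rewrite -(ler_pM2r (expR_gt0 (- ((1 - d) * s)))); apply: le_trans mid_le.
have := expR_gt0 (s * (1 - d ^+ 2 / 8)).
rewrite -expRD; have -> : s * (2 - d - d ^+ 2 / 8) + - ((1 - d) * s) = s * (1 - d ^+ 2 / 8)
  by ring.
lra.
Qed.

Lemma partition_number_ge (eta : R) : 0 < eta -> eta <= 1 ->
  exists m0 : nat, forall m, (m0 <= m)%N ->
  expR ((1 - eta) * (2 * pi / Num.sqrt 6 * Num.sqrt m%:R)) <= (partition_number m)%:R.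
Proof.
move=> e0 e1; pose d := eta / 2.
have d0 : 0 < d by rewrite /d; lra.
have z0 := zeta2_gt0 R.
have [|J HJ] := @inv_squares_ge R (zeta2 R * (d ^+ 2 / 16)).
  by rewrite mulr_gt0 // divr_gt0 // exprn_gt0.
have s6 : 0 < Num.sqrt 6 :> R by rewrite sqrtr_gt0.
have p0 := pi_gt0 R.
(* s >= c is the condition 2 J + 4 <= s d^2 / 16 of the tilting lemma, and m >= [B] is the same
   condition in terms of m. *)
pose c := (2 * J%:R + 4) * 16 / d ^+ 2.
have c0 : 0 < c by rewrite divr_gt0 ?exprn_gt0 // mulr_gt0 // ltr_wpDl // mulr_ge0.
pose B := c ^+ 2 * (1 + d) / zeta2 R.
have B0 : 0 <= B by rewrite divr_ge0 ?(ltW z0) // mulr_ge0 ?exprn_ge0 ?(ltW c0) //; lra.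
exists (Num.bound B) => m mB.
have Bm : B < m%:R.
  apply: (@lt_le_trans _ _ (Num.bound B)%:R); last by rewrite ler_nat.
  exact: archi_boundP.
have m0 : 0 < m%:R :> R by apply: le_lt_trans Bm.
pose s := Num.sqrt (zeta2 R * m%:R / (1 + d)).
have sp0 : 0 < zeta2 R * m%:R / (1 + d) by rewrite divr_gt0 ?mulr_gt0 //; lra.
have s0 : 0 < s by rewrite sqrtr_gt0.
have s2 : s ^+ 2 = zeta2 R * m%:R / (1 + d) by rewrite sqr_sqrtr // ltW.
have cs : c <= s.
  rewrite -(@ler_pXn2r _ 2) ?nnegrE ?(ltW c0) ?(ltW s0) // s2.
  rewrite ler_pdivlMr; last by lra.
  by rewrite mulrC [leRHS]mulrC -ler_pdivrMr // mulrC ltW.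
apply: le_trans (@partition_number_ge_tilted d s J m d0 _ s0 _ _ _); last 4 first.
- by rewrite /d; lra.
- by rewrite s2; field; rewrite !gt_eqF //; lra.
- by rewrite /zeta2 in HJ *; lra.
- move: cs; rewrite /c ler_pdivrMr ?exprn_gt0 //; lra.
rewrite ler_expR.
have zE : Num.sqrt (zeta2 R) = pi / Num.sqrt 6.
  rewrite /zeta2 sqrtrM ?sqr_ge0 // sqrtrV // sqrtr_sqr ger0_norm // ltW //.
have sE : (1 - d) * (pi / Num.sqrt 6 * Num.sqrt m%:R) <= s.
  rewrite -zE -(@ler_pXn2r _ 2) ?nnegrE ?(ltW s0) ?mulr_ge0 ?sqrtr_ge0 //;
    last by rewrite /d; lra.
  rewrite s2 !exprMn !sqr_sqrtr ?(ltW z0) ?(ltW m0) // ler_pdivlMr; last by lra.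
  rewrite mulrAC ler_piMl //; first by rewrite mulr_ge0 // ltW.
  have : 0 <= d ^+ 2 * (1 - d) by rewrite mulr_ge0 ?exprn_ge0 //; rewrite /d; lra.
  rewrite /d in d0 *; nra.
apply: (@le_trans _ _ ((1 - d) * (pi / Num.sqrt 6 * Num.sqrt m%:R) * (2 - d - d ^+ 2 / 8)));
  last first.
  rewrite ler_pM2r //; rewrite /d; nra.
have X0 : 0 <= pi / Num.sqrt 6 * Num.sqrt m%:R :> R by rewrite mulr_ge0 ?sqrtr_ge0 //
  divr_ge0 // ltW.
move: X0; set X := pi / Num.sqrt 6 * _ => X0.
have -> : (1 - eta) * (2 * pi / Num.sqrt 6 * Num.sqrt m%:R) = X * (2 * (1 - eta)).
  by rewrite /X; ring.
have -> : (1 - d) * X * (2 - d - d ^+ 2 / 8) = X * ((1 - d) * (2 - d - d ^+ 2 / 8)) by ring.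
rewrite ler_wpM2l //.
have : 0 <= d ^+ 2 * (1 - d) by rewrite mulr_ge0 ?exprn_ge0 //; rewrite /d; lra.
rewrite /d; nra.
Qed.

End PartitionLowerBound.

(** * Limits inferior and sparse sets *)

Section LimInf.
Variable R : realType.
Implicit Types (u : (\bar R)^nat) (c : \bar R).
Local Open Scope ereal_scope.

Lemma limn_einf_ge u c : (\forall n \near \oo, c <= u n) -> c <= limn_einf u.
Proof.
move=> [N _ Nu]; rewrite limn_einf_lim; apply: lime_ge; first exact: is_cvg_einfs.
exists N => // n /= Nn; apply: le_ereal_inf_tmp => _ [k /= nk <-].
by apply: Nu => /=; exact: leq_trans nk.
Qed.

Lemma limn_einf_le u c : (forall N, exists2 n, (N <= n)%N & u n <= c) -> limn_einf u <= c.
Proof.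
move=> Hu; rewrite limn_einf_lim; apply: lime_le; first exact: is_cvg_einfs.
apply: nearW => N; have [n Nn unc] := Hu N.
by apply: le_trans unc; apply: ereal_inf_lbound; exists n.
Qed.

Lemma limn_einf_lt u c : limn_einf u < c -> forall N, exists2 n, (N <= n)%N & u n < c.
Proof.
move=> uc N; apply: contrapT => H; move: uc; apply/negP; rewrite -leNgt.
apply: limn_einf_ge; exists N => // n /= Nn; rewrite leNgt; apply/negP => un.
by apply: H; exists n.
Qed.

End LimInf.

Section LogRatio.
Variable R : realType.
Implicit Types (A : set nat) (alpha c x y : R).

Lemma log_ratio_le A alpha n c x y : 0 <= x -> 0 < y -> x <= c * y ->
  (num_partitions A n)%:R <= expR x ->
  expR y <= (partition_number (Num.truncn (alpha * n%:R)))%:R ->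
  (log_ratio A alpha n <= c%:E)%E.
Proof.
move=> x0 y0 xcy Px yQ; rewrite /log_ratio.
set P := num_partitions A n in Px *; set Q := (partition_number _)%:R in yQ *.
have Q0 : 0 < Q by apply: lt_le_trans yQ; exact: expR_gt0.
have lnQ : y <= ln Q by rewrite -(expRK y) ler_ln ?posrE ?expR_gt0.
have c0 : 0 <= c by rewrite -(pmulr_lge0 _ y0) (le_trans x0).
have lnQ0 : 0 < ln Q by apply: lt_le_trans lnQ.
rewrite (lne_EFin Q0) inver gt_eqF //.
(* Without any partition of n the numerator is -oo, and so is the quotient, its denominator being
   positive. *)
have [->|P0] := posnP P.
  by rewrite le0_lneNy // mulNyr gtr0_sg ?invr_gt0 // mul1e leNye.
rewrite lne_EFin ?ltr0n // -EFinM lee_fin ler_pdivrMr //.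
apply: (@le_trans _ _ (c * y)); last by rewrite ler_wpM2l.
by apply: le_trans xcy; rewrite -(expRK x) ler_ln ?posrE ?expR_gt0 ?ltr0n.
Qed.

Lemma log_ratio_ge A alpha n c x y : 0 <= c -> c * y <= x ->
  expR x <= (num_partitions A n)%:R ->
  (1 < partition_number (Num.truncn (alpha * n%:R)))%N ->
  (partition_number (Num.truncn (alpha * n%:R)))%:R <= expR y ->
  (c%:E <= log_ratio A alpha n)%E.
Proof.
move=> c0 cyx xP Q1 Qy; rewrite /log_ratio.
set P := (num_partitions A n)%:R in xP *; set Q := (partition_number _) in Q1 Qy *.
have P0 : 0 < P by apply: lt_le_trans xP; exact: expR_gt0.
have Q0 : 0 < Q%:R :> R by rewrite ltr0n ltnW.
have lnQ0 : 0 < ln (Q%:R : R) by rewrite ln_gt0 // ltr1n.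
rewrite (lne_EFin Q0) inver gt_eqF // lne_EFin // -EFinM lee_fin ler_pdivlMr //.
apply: (@le_trans _ _ (c * y)).
  by rewrite ler_wpM2l // -(expRK y) ler_ln ?posrE ?expR_gt0.
by apply: le_trans cyx _; rewrite -(expRK x) ler_ln ?posrE ?expR_gt0.
Qed.

End LogRatio.

(** * Partitions into a set with few elements up to [N] *)

Section UpperBound.
Variable R : realType.
Implicit Types (A : set nat) (n N M k : nat).

Lemma count_uptoE A n : count_upto A n = (\sum_(k < n.+1) ((0 < k) && (val k \in A)))%N.
Proof. by rewrite /count_upto -sum1_card big_mkcond /=; apply: eq_bigr => k _; rewrite inE;
  case: ifP. Qed.

Lemma count_uptoS A n : count_upto A n.+1 = (count_upto A n + (n.+1 \in A))%N.
Proof. by rewrite !count_uptoE big_ord_recr. Qed.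

(* The i-th element of A is at least i. *)
Lemma sum_upto_le_initial A (h : nat -> R) N : ~ A 0%N ->
  (forall k, (0 < k)%N -> h k.+1 <= h k) ->
  \sum_(i < N.+1 | val i \in A) h i <= \sum_(k < count_upto A N) h k.+1.
Proof.
move=> A0 hd; have A0' : (0%N \in A) = false by apply/negbTE; rewrite notin_setE.
elim: N => [|N IH].
  by rewrite big_mkcond big_ord1 /= A0' count_uptoE big_ord1 /= big_ord0.
rewrite big_mkcond big_ord_recr -big_mkcond /= count_uptoS.
case: ifP => NA; rewrite ?addr0 ?addn0 // addn1 big_ord_recr /= lerD //.
have cN : (count_upto A N <= N)%N.
  rewrite count_uptoE big_ord_recl /= add0n.
  apply: (@leq_trans (\sum_(i < N) 1)%N); last by rewrite sum1_card card_ord.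
  by apply: leq_sum => i _; exact: leq_b1.
move: (count_upto A N) cN => c cN.
elim: N cN {IH NA} => [|N IH] cN; first by move: cN; rewrite leqn0 => /eqP ->.
move: cN; rewrite leq_eqVlt => /orP[/eqP -> //|cN].
exact: le_trans (hd N.+1 isT) (IH cN).
Qed.

Lemma log_factor_nincr (t : R) k : 0 < t -> (0 < k)%N -> log_factor t k.+1 <= log_factor t k.
Proof.
move=> t0 k0; rewrite lerN2.
have /andP[_ h1] := expRN_itv t0 k0; have /andP[_ h2] := expRN_itv t0 (ltn0Sn k).
by rewrite ler_ln ?posrE ?subr_gt0 // lerD2l lerN2 ler_expR lerN2 ler_pM2l // ler_nat.
Qed.

(** The factor of k <= M is at most 1 + 1/(tk) <= (1 + 1/(Mt)) (M/k), and the product of the M/k is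
    M^M / M! <= e^M. *)
Lemma sum_log_factor_initial (t : R) M : 0 < t ->
  expR (\sum_(k < M) log_factor t k.+1) <= (1 + (M%:R * t)^-1) ^+ M * expR M%:R.
Proof.
move=> t0; case: M => [|M]; first by rewrite big_ord0 expr0 mul1r.
set m := M.+1.
have m0 : 0 < m%:R :> R by rewrite ltr0n.
have mt0 : 0 < (m%:R * t)^-1 by rewrite invr_gt0 mulr_gt0.
apply: (@le_trans _ _ (\prod_(k < m) ((1 + (m%:R * t)^-1) * (m%:R / k.+1%:R)))).
  rewrite expR_sum; apply: ler_prod => k _; rewrite expR_ge0 /=.
  rewrite expR_log_factor //.
  have k0 : 0 < k.+1%:R :> R by rewrite ltr0n.
  have tk : 0 < t * k.+1%:R by rewrite mulr_gt0.
  have /andP[_ x1] := expRN_itv t0 (ltn0Sn k).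
  have x1' : 0 < 1 - expR (- (t * k.+1%:R)) by rewrite subr_gt0.
  have -> : (1 - expR (- (t * k.+1%:R)))^-1 = 1 + expR (- (t * k.+1%:R)) / (1 - expR (- (t *
    k.+1%:R))).
    by move: x1'; move: (expR _) => x x1'; field; rewrite gt_eqF.
  apply: (@le_trans _ _ (1 + (t * k.+1%:R)^-1)); first by rewrite lerD2l expR_geo_le.
  have km : k.+1%:R <= m%:R :> R by rewrite ler_nat.
  have -> : (1 + (m%:R * t)^-1) * (m%:R / k.+1%:R) = m%:R / k.+1%:R + (t * k.+1%:R)^-1.
    by move: m%:R k.+1%:R m0 k0 {tk x1 x1' km mt0} => a b a0 b0; field; rewrite !gt_eqF.
  by rewrite lerD2r ler_pdivlMr // mul1r.
rewrite big_split /= prodr_const card_ord ler_wpM2l ?exprn_ge0 ?addr_ge0 ?(ltW mt0) //.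
rewrite big_split /= prodr_const card_ord prodfV.
have -> : \prod_(k < m) (k.+1%:R : R) = m`!%:R.
  by rewrite -natr_prod fact_prod big_add1 /= big_mkord.
by apply: le_trans (expR_ge1Dxn M _); rewrite // lerDr.
Qed.

(** Here -ln(1 - z) <= z / (1 - z) with z = e^(-tN) e^(-t(i+1)). The denominators are at least 1 -
    e^(-tN), and the remaining geometric sum is at most 1/t. *)
Lemma sum_log_factor_tail (t : R) N n : 0 < t -> (0 < N)%N ->
  \sum_(i < n) log_factor t (N.+1 + i) <=
  expR (- (t * N%:R)) / (1 - expR (- (t * N%:R))) / t.
Proof.
move=> t0 N0; have /andP[x0 x1] := expRN_itv t0 N0.
set x := expR _ in x0 x1 *; have x1' : 0 < 1 - x by rewrite subr_gt0.
have /andP[y0 y1] := expRN_itv t0 (ltn0Sn 0); rewrite mulr1 in y0 y1.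
apply: (@le_trans _ _ (\sum_(i < n) (x / (1 - x) * (expR (- t) * expR (- t) ^+ i)))).
  apply: ler_sum => i _.
  have E : expR (- (t * (N.+1 + i)%:R)) = x * (expR (- t) * expR (- t) ^+ i).
    rewrite -expRM_natl -!expRD; congr expR; rewrite natrD -(natr1 N); ring.
  have Ni : (0 < N.+1 + i)%N by [].
  apply: le_trans (log_partial_ge 0 (expRN_itv t0 Ni)) _.
  rewrite /log_partial big_ord0 add0r expr1 E.
  have z0 : 0 <= expR (- t) * expR (- t) ^+ i by rewrite mulr_ge0 ?exprn_ge0.
  have z1 : expR (- t) * expR (- t) ^+ i <= 1 by rewrite -exprS exprn_ile1 // ltW.
  move: (expR (- t) * _) z0 z1 => z z0 z1.
  rewrite mulrAC ler_wpM2r // ler_wpM2l // lef_pV2 ?posrE //.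
    by rewrite lerD2l lerN2 ler_piMr.
  by apply: lt_le_trans x1' _; rewrite lerD2l lerN2 ler_piMr.
rewrite -!mulr_sumr ler_wpM2l ?divr_ge0 ?(ltW x1') //.
apply: le_trans (expR_geo_le t0); rewrite ler_wpM2l // geometric_sum_le //.
by rewrite y0.
Qed.

(** At t = L / N the three terms of the exponent come from e^(tn), from the parts up to N and from
    those above N. In the second, M t >= alpha L gives 1 + 1/(Mt) <= 1 + 1/(alpha L) <= 1/alpha =
    e^L, by L >= 2 and alpha <= 1/2. *)
Lemma num_partitions_le_of_count A N M n (alpha : R) : all_positive A ->
  0 < alpha <= 1 / 2 -> 2 <= ln (1 / alpha) -> (0 < N)%N ->
  alpha * N%:R <= M%:R -> (count_upto A N <= M)%N -> n%:R <= alpha * N%:R ^+ 2 ->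
  (num_partitions A n)%:R <= expR (alpha * N%:R * ln (1 / alpha)
     + M%:R * (ln (1 / alpha) + 1) + 2 * alpha * N%:R / ln (1 / alpha)).
Proof.
move=> Apos /andP[a0 a1] L2 N0 aM cM na.
set L := ln _ in L2 *; have L0 : 0 < L by lra.
have N0' : 0 < N%:R :> R by rewrite ltr0n.
pose t := L / N%:R; have t0 : 0 < t by rewrite divr_gt0.
have A0 : ~ A 0%N by move/Apos.
have M0' : 0 < M%:R :> R by apply: lt_le_trans aM; rewrite mulr_gt0.
have eL : expR (- L) = alpha by rewrite /L div1r lnV ?posrE // opprK lnK.
apply: le_trans (num_partitions_le_expR n Apos t0) _.
pose u i := if i \in A then log_factor t i else 0.
have u0 i : 0 <= u i.
  by rewrite /u; case: ifP => //; rewrite in_setE => /Apos i0; exact: log_factor_ge0.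
have split_le : \sum_(i < n.+1 | val i \in A) log_factor t i
    <= \sum_(k < M) log_factor t k.+1 + \sum_(i < n) log_factor t (N.+1 + i).
  rewrite big_mkcond /= -/(u _).
  apply: (@le_trans _ _ (\sum_(i < N.+1 + n) u i)).
    rewrite -(big_mkord xpredT u) addSnnS addnC big_mkord big_split_ord /= lerDl.
    exact: sumr_ge0.
  rewrite big_split_ord /= lerD //; last first.
    by apply: ler_sum => i _; rewrite /u; case: ifP => // _; rewrite log_factor_ge0.
  apply: (@le_trans _ _ (\sum_(k < count_upto A N) log_factor t k.+1)).
    rewrite /u -big_mkcond; apply: sum_upto_le_initial => // k k0.
    exact: log_factor_nincr.
  rewrite -(subnKC cM) big_split_ord /= lerDl sumr_ge0 // => i _.
  exact: log_factor_ge0.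
apply: (@le_trans _ _ (expR (t * n%:R + (\sum_(k < M) log_factor t k.+1
   + \sum_(i < n) log_factor t (N.+1 + i))))); first by rewrite ler_expR lerD2l.
have tn : t * n%:R <= alpha * N%:R * L.
  have -> : alpha * N%:R * L = t * (alpha * N%:R ^+ 2) by rewrite /t; field; rewrite gt_eqF.
  by rewrite ler_wpM2l // ltW.
have tail : \sum_(i < n) log_factor t (N.+1 + i) <= 2 * alpha * N%:R / L.
  apply: le_trans (sum_log_factor_tail n t0 N0) _.
  rewrite (_ : t * N%:R = L); last by rewrite /t divfK // gt_eqF.
  rewrite eL [leRHS](_ : _ = 2 * alpha / t); last by rewrite /t invf_div mulrA.
  rewrite ler_pM2r ?invr_gt0 // ler_pdivrMr; last by lra.
  nra.
have init : expR (\sum_(k < M) log_factor t k.+1) <= expR (M%:R * (L + 1)).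
  apply: le_trans (sum_log_factor_initial M t0) _.
  rewrite mulrDr mulr1 expRD ler_pM2r ?expR_gt0 // expRM_natl.
  apply: lerXn2r; rewrite ?nnegrE ?expR_ge0 //.
    by rewrite addr_ge0 // invr_ge0 mulr_ge0 // ltW.
  have -> : expR L = alpha^-1 by rewrite -[L]opprK expRN eL.
  apply: (@le_trans _ _ (1 + (alpha * L)^-1)).
    rewrite lerD2l lef_pV2 ?posrE ?(mulr_gt0 a0 L0) ?(mulr_gt0 M0' t0) //.
    have -> : alpha * L = alpha * N%:R * t by rewrite /t; field; rewrite gt_eqF.
    by rewrite ler_pM2r.
  rewrite -[leRHS]div1r ler_pdivlMr // mulrDl mul1r invfM -mulrA [L^-1 * _]mulrC mulrA mulVf
    ?gt_eqF //.
  rewrite mul1r; have : L^-1 <= 2^-1 by rewrite lef_pV2 ?posrE.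
  lra.
rewrite !expRD -mulrA; apply: ler_pM; rewrite ?mulr_ge0 ?expR_ge0 //.
  by rewrite ler_expR.
by apply: ler_pM; rewrite ?expR_ge0 // ler_expR.
Qed.

End UpperBound.

(** * Upper bound for the ratio *)

(** The infimum of the admissible nonnegative errors at a need not be admissible, but adding a > 0
    makes it so by monotonicity, and the sum still tends to 0. *)
Lemma select_vanishing (R : realType) (P : R -> R -> Prop) :
  (forall a e e', 0 < a < 1 -> e <= e' -> P a e -> P a e') ->
  (forall a, 0 < a < 1 -> exists e, P a e) ->
  (forall e, 0 < e -> exists2 a0, 0 < a0 & forall a, 0 < a < 1 -> a <= a0 -> P a e) ->
  exists2 eps : R -> R, eps a @[a --> 0^'+] --> (0 : R) &
    forall a, 0 < a < 1 -> P a (eps a).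
Proof.
move=> Pmono Pex Psmall.
pose S a := [set e : R | 0 <= e /\ P a e].
have Slb a : has_lbound (S a) by exists 0 => e [].
have Sinf a : 0 < a < 1 -> has_inf (S a).
  move=> a01; split=> //; have [e Pe] := Pex a a01.
  exists (Num.max 0 e); split; first by rewrite le_max lexx.
  by apply: Pmono Pe => //; rewrite le_max lexx orbT.
exists (fun a => inf (S a) + a); last first.
  move=> a a01; have /andP[a0 _] := a01.
  have [e [e0 Pe] lt_e] := inf_adherent a0 (Sinf a a01).
  by apply: Pmono Pe => //; exact: ltW.
apply/cvgrPdist_le => e e0.
have e20 : 0 < e / 2 by rewrite divr_gt0.
have [a0 a00 Ha0] := Psmall (e / 2) e20.
near=> a.
have a01 : 0 < a < 1.
  by apply/andP; split; near: a; [exact: nbhs_right_gt|exact: nbhs_right_lt].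
have aa0 : a <= a0 by near: a; exact: nbhs_right_le.
have ae : a <= e / 2 by near: a; exact: nbhs_right_le.
have inf_le : inf (S a) <= e / 2.
  by apply: ge_inf => //; split; [exact: ltW|exact: Ha0].
have inf_ge : 0 <= inf (S a).
  by apply: lb_le_inf; [case: (Sinf a a01)|move=> x []].
have /andP[ap _] := a01.
rewrite sub0r normrN ger0_norm ?addr_ge0 ?(ltW ap) //.
by rewrite (splitr e) lerD.
Unshelve. all: by end_near. Qed.

Section RatioUpperBound.
Variable R : realType.
Implicit Types (A : set nat) (alpha eta : R).

Lemma log_ratio_inf_le A alpha eta : all_positive A ->
  natural_lower_density R A = alpha%:E ->
  0 < eta <= 1 / 4 -> 0 < alpha <= 1 / 2 -> 2 / eta <= ln (1 / alpha) ->
  (limn_einf (log_ratio A alpha)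
   <= ((1 + 8 * eta) * (Num.sqrt 6 / pi) * ln (1 / alpha))%:E)%E.
Proof.
move=> Apos dA /andP[e0 e1] a01 Lbig; have /andP[a0 a1] := a01.
set L := ln _ in Lbig *.
have L8 : 8 <= L.
  by apply: le_trans Lbig; rewrite ler_pdivlMr //; lra.
have [m0 Hm0] := @partition_number_ge R eta e0 ltac:(lra).
apply: limn_einf_le => K0.
(* X = alpha N >= [W] makes the roundings of M, n and alpha n negligible (eta X >= 1 and X >= 2) and
   pushes n beyond [K0] and floor(alpha n) beyond [m0]. *)
pose W : R := m0%:R + K0%:R + 2 + 1 / eta.
have dlt : (limn_einf (fun n : nat => ((count_upto A n)%:R / n%:R : R)%:E)
    < (alpha * (1 + eta))%:E)%E.
  by rewrite -/(natural_lower_density R A) dA lte_fin ltr_pMr // ltrDl.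
have [N NK] := limn_einf_lt dlt (Num.bound (W / alpha)).
rewrite lte_fin => cN; clear dlt dA.
have ie : 0 < 1 / eta by rewrite divr_gt0.
have m00 : 0 <= m0%:R :> R by [].
have K00 : 0 <= K0%:R :> R by [].
have WN : W <= alpha * N%:R.
  rewrite mulrC -ler_pdivrMr //; apply: (@le_trans _ _ (Num.bound (W / alpha))%:R).
    by apply/ltW/archi_boundP; rewrite divr_ge0 ?(ltW a0) // /W; lra.
  by rewrite ler_nat.
pose X := alpha * N%:R.
have XE : X = alpha * N%:R by [].
rewrite -XE in WN; clearbody X.
have eX : 1 <= eta * X.
  rewrite mulrC -ler_pdivrMr //; apply: le_trans WN; rewrite /W; lra.
have X2 : 2 <= X by apply: le_trans WN; rewrite /W; lra.
have N0 : (0 < N)%N by rewrite lt0n; apply/eqP => N0; move: X2; rewrite XE N0 mulr0; lra.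
have N0' : 0 < N%:R :> R by rewrite ltr0n.
have L0 : 0 < L by lra.
have X0 : 0 < X by lra.
have u0 : 0 < 1 - eta by lra.
have v0 : 0 < 1 + 2 * eta by lra.
have w0 : 0 < 1 + eta by lra.
have N1 : 1 <= N%:R :> R by rewrite ler1n.
pose M := (Num.truncn ((1 + eta) * X)).+1.
have T0 : 0 <= (1 + eta) * X by rewrite mulr_ge0 // ltW.
have /andP[M1 M2] := truncn_itv T0; rewrite -/M in M2.
have M1' : M%:R <= (1 + 2 * eta) * X by rewrite /M -natr1; lra.
have cM : (count_upto A N <= M)%N.
  rewrite -(ler_nat R); apply/ltW; apply: le_lt_trans M2.
  by move: cN; rewrite ltr_pdivrMr // => /ltW; rewrite XE; lra.
have aM : X <= M%:R by apply: le_trans (ltW M2); nra.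
pose n := Num.truncn (alpha * N%:R ^+ 2).
have aN0 : 0 <= alpha * N%:R ^+ 2 by rewrite mulr_ge0 ?exprn_ge0 // ltW.
have /andP[n1 n2] := truncn_itv aN0; rewrite -/n in n1 n2.
have XN : X <= alpha * N%:R ^+ 2 by rewrite XE expr2 mulrA ler_peMr // mulr_ge0 // ltW.
exists n.
  by rewrite /n truncn_ge_nat //; apply: le_trans XN; apply: le_trans WN; rewrite /W; lra.
pose m := Num.truncn (alpha * n%:R).
have an0 : 0 <= alpha * n%:R by rewrite mulr_ge0 // ltW.
have /andP[_ m2] := truncn_itv an0; rewrite -/m in m2.
have mX : (1 - eta) ^+ 2 * X ^+ 2 <= m%:R.
  rewrite -natr1 in m2; rewrite -natr1 in n2.
  have : alpha * (alpha * N%:R ^+ 2) <= alpha * (n%:R + 1) by rewrite ler_pM2l // ltW.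
  have -> : alpha * (alpha * N%:R ^+ 2) = X ^+ 2 by rewrite XE; ring.
  have : 2 * 1 <= X * (eta * X) by rewrite ler_pM //; lra.
  have : 0 <= eta * (1 - eta) * X ^+ 2 by rewrite !mulr_ge0 ?exprn_ge0 // ltW.
  rewrite expr2; nra.
have mm0 : (m0 <= m)%N.
  rewrite -(ler_nat R); apply: le_trans mX; apply: (@le_trans _ _ X).
    by apply: le_trans WN; rewrite /W; lra.
  have : 9 / 16 <= (1 - eta) ^+ 2 by nra.
  by rewrite expr2 mulrA; nra.
have s6 : 0 < Num.sqrt 6 :> R by rewrite sqrtr_gt0.
have p0 := pi_gt0 R.
have sm : (1 - eta) * X <= Num.sqrt m%:R.
  rewrite -[leLHS]ger0_norm; last by rewrite mulr_ge0 // ltW.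
  by rewrite -sqrtr_sqr ler_wsqrtr // exprMn.
(* In the numerator the terms of size X are absorbed because eta L >= 2. The denominator loses 1 -
   eta in the estimate of p and again in sqrt m >= (1 - eta) X, and 1 + 2 eta <= (1 + 8 eta) (1 -
   eta)^2 for eta <= 1/4. *)
apply: (@log_ratio_le R A alpha n _ (2 * X * L * (1 + 2 * eta))
   ((1 - eta) * (2 * pi / Num.sqrt 6 * ((1 - eta) * X)))).
- by rewrite !mulr_ge0 // ltW.
- by rewrite !mulr_gt0 ?invr_gt0.
- have -> : (1 + 8 * eta) * (Num.sqrt 6 / pi) * L * ((1 - eta) * (2 * pi / Num.sqrt 6 * ((1 -
  eta) * X)))
     = 2 * X * L * ((1 + 8 * eta) * (1 - eta) ^+ 2).
    by move: (Num.sqrt 6) (pi : R) s6 p0 => s p s0 p0; field; rewrite !gt_eqF.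
  rewrite ler_pM2l ?mulr_gt0 //.
  have : 0 <= eta ^+ 3 by rewrite exprn_ge0 // ltW.
  have : 0 <= eta * (1 / 4 - eta) by rewrite mulr_ge0 ?(ltW e0) // subr_ge0.
  clear -e0 e1; lra.
- rewrite XE in aM; have L2 : 2 <= L by lra.
  apply: le_trans (num_partitions_le_of_count Apos a01 L2 N0 aM cM n1) _.
  rewrite ler_expR -/L -XE.
  have t1 : M%:R * (L + 1) <= (1 + 2 * eta) * X * (L + 1) by rewrite ler_pM2r // addr_gt0.
  have t2 : 2 * alpha * N%:R / L <= X * (1 / 4).
    have -> : 2 * alpha * N%:R / L = X * (2 / L) by rewrite XE; ring.
    by rewrite ler_pM2l // ler_pdivrMr //; clear -L8; lra.
  have t3 : X * 2 <= X * (eta * L).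
    by rewrite ler_pM2l // mulrC -ler_pdivrMr.
  have t4 : 2 * eta * X <= 1 / 2 * X by rewrite ler_pM2r //; clear -e1; lra.
  clear -t1 t2 t3 t4 eX; lra.
- apply: le_trans (Hm0 m mm0); rewrite ler_expR ler_pM2l //.
  by rewrite ler_pM2l // !mulr_gt0 ?invr_gt0.
Qed.

(** Compares with the bound valid for all partitions of n. Its purpose is finiteness: it provides an
    admissible error for each alpha in (0, 1). *)
Lemma log_ratio_inf_lty A alpha : all_positive A -> 0 < alpha ->
  (limn_einf (log_ratio A alpha) <= (4 / Num.sqrt alpha)%:E)%E.
Proof.
move=> Apos a0.
have [m0 Hm0] := @partition_number_ge R (1 / 2) ltac:(lra) ltac:(lra).
have s6 : 0 < Num.sqrt 6 :> R by rewrite sqrtr_gt0.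
have sa : 0 < Num.sqrt alpha by rewrite sqrtr_gt0.
have p0 := pi_gt0 R.
apply: limn_einf_le => K0; pose W : R := (m0%:R + 4) / alpha.
have m00 : 0 <= m0%:R :> R by [].
have W0 : 0 <= W by rewrite divr_ge0 ?(ltW a0) //; lra.
pose n := (K0 + Num.bound W)%N.
have an : m0%:R + 4 <= alpha * n%:R.
  rewrite mulrC -ler_pdivrMr //; apply: le_trans (ltW (archi_boundP W0)) _.
  by rewrite ler_nat leq_addl.
have n0 : (0 < n)%N by rewrite lt0n; apply/eqP => n0; move: an; rewrite n0 mulr0; lra.
have sn : 0 < Num.sqrt n%:R :> R by rewrite sqrtr_gt0 ltr0n.
exists n; first by rewrite leq_addr.
have an0 : 0 <= alpha * n%:R by lra.
have /andP[_ m2] := truncn_itv an0; move: m2; set m := Num.truncn _ => m2.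
rewrite -natr1 in m2.
have mm0 : (m0 <= m)%N by rewrite /m truncn_ge_nat //; lra.
apply: (@log_ratio_le R A alpha n _ (2 * pi / Num.sqrt 6 * Num.sqrt n%:R)
  ((1 - 1 / 2) * (2 * pi / Num.sqrt 6 * (Num.sqrt alpha * Num.sqrt n%:R / 2)))).
- by rewrite !mulr_ge0 ?invr_ge0; lra.
- by rewrite !mulr_gt0 ?invr_gt0; lra.
- rewrite le_eqVlt; apply/orP; left; apply/eqP.
  move: (Num.sqrt 6) (Num.sqrt alpha) (pi : R) s6 sa p0 => s b p s0 b0 p0.
  by field; rewrite !gt_eqF.
- exact: num_partitions_le.
- apply: le_trans (Hm0 m mm0); rewrite ler_expR ler_pM2l; last by lra.
  rewrite ler_pM2l; last by rewrite !mulr_gt0 ?invr_gt0; lra.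
  have -> : Num.sqrt alpha * Num.sqrt n%:R / 2 = Num.sqrt (alpha * n%:R * (1 / 2) ^+ 2).
    rewrite sqrtrM // sqrtr_sqr ger0_norm ?divr_ge0 // sqrtrM ?(ltW a0) //.
    by rewrite div1r.
  by rewrite ler_wsqrtr //; lra.
Qed.

Lemma exists_eps2 : exists2 eps : R -> R, eps a @[a --> 0^'+] --> (0 : R) &
  forall alpha, 0 < alpha < 1 -> forall A, all_positive A ->
    natural_lower_density R A = alpha%:E ->
    (limn_einf (log_ratio A alpha)
     <= ((1 + eps alpha) * (Num.sqrt 6 / pi) * ln (1 / alpha))%:E)%E.
Proof.
have s6 : 0 < Num.sqrt 6 / pi :> R by rewrite divr_gt0 ?sqrtr_gt0 ?pi_gt0.
apply: (@select_vanishing R (fun alpha e => forall A, all_positive A ->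
    natural_lower_density R A = alpha%:E ->
    (limn_einf (log_ratio A alpha)
     <= ((1 + e) * (Num.sqrt 6 / pi) * ln (1 / alpha))%:E)%E)).
- move=> a e e' /andP[a0 a1] ee' H A Apos dA; apply: le_trans (H A Apos dA) _.
  rewrite lee_fin ler_wpM2r //; last by rewrite ler_pM2r // lerD2l.
  by rewrite ln_ge0 // div1r invf_ge1 // ltW.
- move=> a /andP[a0 a1].
  have L0 : 0 < ln (1 / a) by rewrite ln_gt0 // div1r invf_gt1.
  exists (4 / Num.sqrt a / (Num.sqrt 6 / pi * ln (1 / a)) - 1) => A Apos dA.
  apply: le_trans (log_ratio_inf_lty Apos a0) _.
  rewrite lee_fin addrC subrK -mulrA divfK // gt_eqF // mulr_gt0 //.
- move=> e e0; pose eta := Num.min (1 / 4) (e / 8).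
  have h0 : 0 < eta by rewrite lt_min; apply/andP; split; lra.
  have h1 : eta <= 1 / 4 by rewrite ge_min lexx.
  have h2 : eta <= e / 8 by rewrite ge_min lexx orbT.
  exists (Num.min (1 / 2) (expR (- (2 / eta)))); first by rewrite lt_min expR_gt0 andbT; lra.
  move=> a /andP[a0 a1]; rewrite le_min => /andP[a2 aE] A Apos dA.
  have aL : 2 / eta <= ln (1 / a).
    rewrite -(expRK (2 / eta)) ler_ln ?posrE ?expR_gt0 ?divr_gt0 //.
    by rewrite div1r -[expR _]invrK -expRN lef_pV2 ?posrE ?expR_gt0.
  apply: le_trans (log_ratio_inf_le Apos dA _ _ aL) _; [exact/andP|exact/andP|].
  rewrite lee_fin ler_wpM2r //; last by rewrite ler_pM2r //; lra.
  by apply: le_trans aL; rewrite divr_ge0 // ltW.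
Qed.

End RatioUpperBound.

(** * A set with gaps *)

Lemma exists_step (f : nat -> nat) n : (f 0 <= n)%N -> (exists j, n < f j)%N ->
  exists j, (f j <= n < f j.+1)%N.
Proof.
move=> f0 H; case: (ex_minnP H) => -[|j] jn jmin; first by move: jn; rewrite ltnNge f0.
by exists j; rewrite jn andbT leqNgt; apply/negP => /jmin; rewrite ltnn.
Qed.

Lemma leq_self_fact n : (n <= n`!)%N.
Proof. by case: n => // n; rewrite factS leq_pmulr // fact_gt0. Qed.

Lemma leq_count_upto (A : set nat) : {homo count_upto A : m n / (m <= n)%N}.
Proof. by apply: homo_leq => // [y x z|n]; [exact: leq_trans|rewrite count_uptoS leq_addr]. Qed.

Lemma fact_nd : {homo factorial : m n / (m <= n)%N}.
Proof.
by apply: homo_leq => // [y x z|n]; [exact: leq_trans|rewrite factS leq_pmull].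
Qed.

Lemma count_upto_interval (A : set nat) a b : (forall k, a < k <= b -> A k)%N ->
  (a <= b)%N -> (count_upto A a + (b - a) <= count_upto A b)%N.
Proof.
move=> H /subnKC; move: (b - a)%N => r br; rewrite -{}br in H *.
elim: r H => [|r IH] H; first by rewrite !addn0.
rewrite [in leqRHS]addnS count_uptoS mem_set; last by apply: H; lia.
by rewrite addn1 addnS ltnS; apply: IH => k ak; apply: H; lia.
Qed.

Lemma count_upto_two_intervals (A : set nat) a b c d n :
  (forall k, a < k <= b -> A k)%N -> (forall k, c < k <= d -> A k)%N ->
  (b <= c)%N -> (c <= d)%N -> (d <= n)%N -> ((b - a) + (d - c) <= count_upto A n)%N.
Proof.
move=> Hab Hcd bc cd dn; apply: leq_trans (leq_count_upto A dn).
apply: leq_trans (count_upto_interval Hcd cd); rewrite leq_add2r.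
have [ba|/ltnW ab] := leqP b a; first by rewrite (eqP ba).
apply: leq_trans (leq_count_upto A bc).
by apply: leq_trans (count_upto_interval Hab ab); rewrite leq_addl.
Qed.

Section GappedSet.
Variables (R : realType) (alpha : R).

Definition gap_start j : nat := Num.truncn (alpha * j`!%:R).

(** The gaps end at factorials because their successive ratios are unbounded: what lies below j! is
    negligible against alpha (j+1)!. The number 1 is kept even inside a gap; it forces the gcd to be
    1 and serves as filling part. *)
Definition gapped_set : set nat :=
  [set k | k = 1%N \/ (0 < k)%N /\ forall j, ~~ (gap_start j < k <= j`!)%N].

Lemma gapped_set_positive : all_positive gapped_set.
Proof. by move=> k [->//|[]]. Qed.

Lemma gapped_set1 : gapped_set 1%N.
Proof. by left. Qed.

Lemma gapped_set_gcd : is_gcd gapped_set 1.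
Proof. by split=> [a _|d Hd]; [exact: dvd1n|exact: Hd gapped_set1]. Qed.

Hypothesis alpha01 : 0 < alpha < 1.

Let a0 : 0 < alpha. Proof. by case/andP: alpha01. Qed.
Let a1 : alpha < 1. Proof. by case/andP: alpha01. Qed.

Lemma gap_start_itv j : (gap_start j)%:R <= alpha * j`!%:R < (gap_start j).+1%:R.
Proof. by apply: truncn_itv; rewrite mulr_ge0 // ltW. Qed.

Lemma gap_start_nd : {homo gap_start : i j / (i <= j)%N}.
Proof.
move=> i j ij; apply: le_truncn; rewrite ler_wpM2l ?(ltW a0) // ler_nat.
by apply: fact_nd.
Qed.

Lemma gap_start_le j : (gap_start j <= j`!)%N.
Proof.
rewrite -(ler_nat R); have /andP[h _] := gap_start_itv j; apply: le_trans h _.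
by rewrite ler_piMl // ltW.
Qed.

Lemma gapped_set_block j k : (j`! < k <= gap_start j.+1)%N -> gapped_set k.
Proof.
move=> /andP[jk kj]; right; split; first exact: leq_ltn_trans jk.
move=> i; rewrite negb_and -leqNgt -ltnNge; have [ij|ji] := leqP i j.
  by apply/orP; right; apply: leq_ltn_trans jk; exact: fact_nd.
by apply/orP; left; apply: leq_trans kj _; exact: gap_start_nd.
Qed.

Lemma count_gapped_le j : (count_upto gapped_set j`! <= (gap_start j).+1)%N.
Proof.
suff H n : (n <= j`!)%N -> (count_upto gapped_set n <= minn n (gap_start j).+1)%N.
  by apply: leq_trans (H _ (leqnn _)) _; exact: geq_minr.
elim: n => [|n IH] nj; first by rewrite count_uptoE big_ord1.
have := IH (ltnW nj); rewrite count_uptoS.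
have [nM|Mn] := leqP n.+1 (gap_start j).+1; first by case: (_ \in _) => /=; lia.
rewrite memNset; first by lia.
by move=> [n1|[_ /(_ j)]]; lia.
Qed.

(** Only the blocks after j! and after (j+1)! are counted. Up to the next gap both are used and the
    loss is j! + 1. Inside that gap the second block suffices, with loss (j+1)! + 1, since there n
    is at least about alpha (j+2)!. Either factorial is at most n / (alpha (j+1)). *)
Lemma count_gapped_ge n j : (j.+1`! <= n < j.+2`!)%N ->
  (alpha - 2 / (alpha * j.+1%:R)) * n%:R <= (count_upto gapped_set n)%:R.
Proof.
move=> /andP[jn nj].
have N0 : 0 < j`!%:R :> R by rewrite ltr0n fact_gt0.
have E1 : j.+1`!%:R = j.+1%:R * j`!%:R :> R by rewrite factS natrM.
have E2 : j.+2`!%:R = (j.+1%:R + 1) * j.+1`!%:R :> R by rewrite factS natrM natr1.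
have J0 : 1 <= j.+1%:R :> R by rewrite ler1n.
have F1 : 1 <= j`!%:R :> R by rewrite ler1n fact_gt0.
have /andP[m1 m2] := gap_start_itv j.+1; have /andP[l1 l2] := gap_start_itv j.+2.
rewrite -natr1 in m2; rewrite -natr1 in l2.
have jn' : j.+1`!%:R <= n%:R :> R by rewrite ler_nat.
have nj' : n%:R <= j.+2`!%:R :> R by rewrite ler_nat ltnW.
have n0 : 0 < n%:R :> R by apply: lt_le_trans jn'; rewrite E1 mulr_gt0 //; lra.
have t0 : 0 < alpha * j.+1%:R by rewrite mulr_gt0 //; lra.
suff : alpha * n%:R - 2 * (n%:R / (alpha * j.+1%:R)) <= (count_upto gapped_set n)%:R.
  by rewrite mulrBl -mulrA [_^-1 * _]mulrC.
have [nM|Mn] := leqP n (gap_start j.+2).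
  have jm : j.+1`!%:R <= n%:R / alpha :> R.
    rewrite ler_pdivlMr //; apply: le_trans jn'.
    by rewrite ler_piMr // ltW.
  have h1 : j`!%:R <= n%:R / (alpha * j.+1%:R).
    by rewrite ler_pdivlMr // mulrCA mulrC -ler_pdivlMr // mulrC -E1.
  have : ((gap_start j.+1 - j`!) + (n - j.+1`!) <= count_upto gapped_set n)%N.
    apply: count_upto_two_intervals => //.
    - exact: gapped_set_block.
    - by move=> k /andP[jk kn]; apply: (@gapped_set_block j.+1); rewrite jk (leq_trans kn).
    - exact: gap_start_le.
  rewrite -(ler_nat R) natrD [X in _ + X <= _]natrB //; apply: le_trans.
  have g1 : (gap_start j.+1)%:R <= (gap_start j.+1 - j`!)%:R + j`!%:R :> R.
    by rewrite -natrD ler_nat addnC -leq_subLR.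
  have g2 : 0 <= (1 - alpha) * (n%:R - j.+1`!%:R) by rewrite mulr_ge0 // subr_ge0 // ltW.
  have arith (f0 f1 x T g nn : R) : f0 <= T -> 1 <= f0 -> alpha * f1 < g + 1 ->
      g <= x + f0 -> 0 <= (1 - alpha) * (nn - f1) -> alpha * nn - 2 * T <= x + (nn - f1).
    by clear; lra.
  exact: arith h1 F1 m2 g1 g2.
have h1 : j.+1`!%:R <= n%:R / (alpha * j.+1%:R).
  rewrite ler_pdivlMr //.
  have g1 : (gap_start j.+2)%:R + 1 <= n%:R :> R by rewrite natr1 ler_nat.
  have g2 : 0 <= alpha * j.+1`!%:R by rewrite mulr_ge0 // ltW.
  have arith (f x g nn : R) : alpha * ((x + 1) * f) < g + 1 -> g + 1 <= nn ->
      0 <= alpha * f -> f * (alpha * x) <= nn by clear; lra.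
  by apply: arith g1 g2; rewrite -E2.
have h2 : 1 <= j.+1`!%:R :> R by rewrite ler1n fact_gt0.
have [jM|Mj] := leqP (j.+1`!) (gap_start j.+2); last first.
  have g1 : (gap_start j.+2)%:R <= j.+1`!%:R :> R by rewrite ler_nat ltnW.
  have g2 : alpha * n%:R <= alpha * j.+2`!%:R by rewrite ler_pM2l.
  apply: (@le_trans _ _ 0) => //.
  have arith (f1 f2 T g nn : R) : 1 <= f1 -> f1 <= T -> g <= f1 ->
      alpha * nn <= alpha * f2 -> alpha * f2 < g + 1 -> alpha * nn - 2 * T <= 0.
    by clear; lra.
  exact: arith h2 h1 g1 g2 l2.
have : ((gap_start j.+1 - j`!) + (gap_start j.+2 - j.+1`!) <= count_upto gapped_set n)%N.
  apply: count_upto_two_intervals => //; last exact: ltnW.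
  - exact: gapped_set_block.
  - exact: gapped_set_block.
  - exact: gap_start_le.
rewrite -(ler_nat R) natrD [X in _ + X <= _]natrB //; apply: le_trans.
have g1 : 0 <= (gap_start j.+1 - j`!)%:R :> R by [].
have g2 : alpha * n%:R <= alpha * j.+2`!%:R by rewrite ler_pM2l.
have arith (x f1 f2 T g nn : R) : 0 <= x -> 1 <= f1 -> f1 <= T ->
    alpha * nn <= alpha * f2 -> alpha * f2 < g + 1 -> alpha * nn - 2 * T <= x + (g - f1).
  by clear; lra.
exact: arith g1 h2 h1 g2 l2.
Qed.

Lemma gapped_set_density : natural_lower_density R gapped_set = alpha%:E.
Proof.
apply/eqP; rewrite eq_le; apply/andP; split; apply/lee_addgt0Pr => e e0.
  apply: limn_einf_le => K; pose j := maxn K (Num.bound e^-1).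
  exists j`!; first by apply: leq_trans (leq_self_fact _); exact: leq_maxl.
  have N0 : 0 < j`!%:R :> R by rewrite ltr0n fact_gt0.
  rewrite -EFinD lee_fin ler_pdivrMr //.
  have := count_gapped_le j; rewrite -(ler_nat R) => /le_trans; apply.
  have /andP[h _] := gap_start_itv j; rewrite -natr1 mulrDl lerD //.
  rewrite -ler_pdivrMl // mulr1.
  have /ltW/le_trans : e^-1 < (Num.bound e^-1)%:R by apply: archi_boundP; rewrite invr_ge0 ltW.
  by apply; rewrite ler_nat; apply: leq_trans (leq_self_fact _); exact: leq_maxr.
rewrite -leeBlDr // -EFinB.
apply: limn_einf_ge.
pose K := (Num.bound (2 / (alpha * e))).+1.
exists K`! => // n /= Kn.
have K0 : (0 < n)%N by apply: leq_trans Kn; exact: fact_gt0.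
have [|j jn] := @exists_step (fun j => j.+1`!) n K0; first by exists n; exact: leq_self_fact.
have n0 : 0 < n%:R :> R by rewrite ltr0n.
rewrite lee_fin ler_pdivlMr //; apply: le_trans (count_gapped_ge jn).
rewrite ler_wpM2r // lerD2l lerN2.
have Kj : (K <= j.+1)%N.
  rewrite leqNgt; apply/negP => jK; have /andP[_] := jn.
  by apply/negP; rewrite -leqNgt; apply: leq_trans Kn; exact: fact_nd.
rewrite ler_pdivrMr ?mulr_gt0 // mulrCA mulrA -ler_pdivrMl ?mulr_gt0 // mulrC.
have h0 : 0 <= 2 / (alpha * e) by rewrite divr_ge0 // mulr_ge0 // ltW.
apply: le_trans (ltW (archi_boundP h0)) _; rewrite ler_nat.
by apply: leq_trans Kj.
Qed.

End GappedSet.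

(** * Partitions into parts of the set with gaps *)

Section GappedPartitions.
Variable R : realType.
Implicit Types (alpha d L : R) (n i : nat).

Lemma expR_half_le_pow2 k : expR (k%:R / 2) <= (2 ^ k)%:R :> R.
Proof.
rewrite expRM_natl natrX lerXn2r ?nnegrE ?expR_ge0 //.
rewrite -[2^-1]opprK expRN invf_ple ?posrE ?expR_gt0 //.
by apply: le_trans (expR_ge1Dx _); lra.
Qed.

Lemma gapped_num_partitions_gt0 alpha n : (0 < num_partitions (gapped_set alpha) n)%N.
Proof.
have := @num_partitions_slots (gapped_set alpha) n 1 1 0 1 0 1 (gapped_set1 alpha).
by apply => // k; lia.
Qed.

(** The hypothesis on i expresses that i! is at most a fraction d/8 of alpha (i+1)!; the rounding
    error 1 is then covered as well. *)
Lemma gap_start_bounds alpha d i : 0 < alpha < 1 -> 0 < d ->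
  8 <= i.+1%:R * d * alpha ->
  [/\ i`!%:R <= d * (alpha * i.+1`!%:R) / 8, 1 <= d * (alpha * i.+1`!%:R) / 8,
      alpha * i.+1`!%:R - d * (alpha * i.+1`!%:R) / 8 <= (gap_start alpha i.+1)%:R
    & (gap_start alpha i.+1)%:R <= alpha * i.+1`!%:R].
Proof.
move=> a01 d0 big.
have F1 : 1 <= i`!%:R :> R by rewrite ler1n fact_gt0.
have E : i.+1`!%:R = i.+1%:R * i`!%:R :> R by rewrite factS natrM.
have h1 : i`!%:R <= d * (alpha * i.+1`!%:R) / 8.
  have : 8 * i`!%:R <= i.+1%:R * d * alpha * i`!%:R by rewrite ler_pM2r //;
    apply: lt_le_trans F1.
  by rewrite E; lra.
have /andP[m1 m2] := gap_start_itv a01 i.+1; rewrite -natr1 in m2.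
have h2 := le_trans F1 h1; split => //.
by rewrite lerBlDr; apply/ltW/(lt_le_trans m2); rewrite lerD2l.
Qed.

Lemma gap_start_double alpha d i : 0 < alpha < 1 -> d <= 1 / 4 ->
  8 <= i.+1%:R * d * alpha -> (i.+1`! + i.+1`! <= gap_start alpha i.+2)%N.
Proof.
move=> a01 d1 big; have /andP[a0 _] := a01.
have /andP[_ m2] := gap_start_itv a01 i.+2.
rewrite -ltnS -(ltr_nat R); apply: le_lt_trans m2.
have -> : i.+2`!%:R = (i.+1%:R + 1) * i.+1`!%:R :> R by rewrite factS natrM natr1.
rewrite natrD.
have N0 : 0 <= i.+1`!%:R :> R by [].
have : 2 <= alpha * (i.+1%:R + 1).
  have : 0 <= (1 / 4 - d) * (i.+1%:R * alpha) by rewrite mulr_ge0 ?mulr_ge0 ?(ltW a0) //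
    subr_ge0.
  by move: big a0; clear; move: (i.+1%:R) => x *; lra.
rewrite -subr_ge0 => /mulr_ge0/(_ N0); clear; move: (i.+1%:R) (i.+1`!%:R) => x y; lra.
Qed.

(** Sets of distinct parts from (P, 2P] have sum at most 4 P^2 <= n, and there are 2^P >= e^(P/2) of
    them. With X = sqrt(alpha n) L, P >= 4 X is wanted; 256 gives X <= alpha (i+1)! / 16, so that
    (P, 2P] ends before the gap. *)
Lemma gapped_partitions_low alpha d L i n : 0 < alpha < 1 -> 0 < d <= 1 / 4 ->
  0 < L -> 8 <= i.+1%:R * d * alpha -> 16 * (Num.sqrt alpha * L) <= 1 ->
  (16 <= n)%N -> (4 * i`! ^ 2 <= n)%N ->
  n%:R * (256 * L ^+ 2) <= alpha * i.+1`!%:R ^+ 2 ->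
  expR (2 * Num.sqrt (alpha * n%:R) * L) <= (num_partitions (gapped_set alpha) n)%:R.
Proof.
move=> a01 /andP[d0 d1] L0 big aL n16 Pn nle; have /andP[a0 _] := a01.
have [h1 h2 h3 h4] := gap_start_bounds a01 d0 big.
have XE : Num.sqrt (alpha * n%:R) = Num.sqrt alpha * Num.sqrt n%:R by rewrite sqrtrM // ltW.
pose X := Num.sqrt (alpha * n%:R) * L.
have X0 : 0 <= X by rewrite mulr_ge0 ?sqrtr_ge0 // ltW.
have a'0 : 0 <= alpha * i.+1`!%:R by rewrite mulr_ge0 // ltW.
have Xa : X <= alpha * i.+1`!%:R / 16.
  rewrite -(@ler_pXn2r _ 2) ?nnegrE ?divr_ge0 //.
  rewrite /X exprMn sqr_sqrtr ?mulr_ge0 ?(ltW a0) //.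
  have : alpha * (n%:R * (256 * L ^+ 2)) <= alpha * (alpha * i.+1`!%:R ^+ 2) by rewrite
    ler_pM2l.
  by rewrite expr_div_n exprMn; move: (i.+1`!%:R ^+ 2) (L ^+ 2) (n%:R) => *; lra.
have S4 : 4 <= Num.sqrt n%:R :> R.
  rewrite -[4]ger0_norm // -sqrtr_sqr ler_wsqrtr // -natrX ler_nat //.
have Xn : X <= Num.sqrt n%:R / 16.
  have : 16 * (Num.sqrt alpha * L) * Num.sqrt n%:R <= 1 * Num.sqrt n%:R.
    by rewrite ler_pM2r //; apply: lt_le_trans S4.
  by rewrite /X XE; clear; lra.
have T0 : 0 <= 4 * X by rewrite mulr_ge0.
pose T := (Num.truncn (4 * X)).+1.
have /andP[T1 T2] := truncn_itv T0; rewrite -/T in T2.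
have {}T1 : T%:R <= 4 * X + 1 by rewrite /T -natr1 lerD2r.
have TM : (2 * T <= gap_start alpha i.+1)%N.
  rewrite -(ler_nat R) natrM; apply: le_trans h3.
  move: T1 Xa h2 d1 a'0; clear; move: (alpha * _) => a *; nra.
have PM : (2 * i`! <= gap_start alpha i.+1)%N.
  rewrite -(ler_nat R) natrM; apply: le_trans h3.
  move: h1 d1 a'0; clear; move: (alpha * _) => a *; nra.
have Tn : (4 * T ^ 2 <= n)%N.
  rewrite -(ler_nat R) natrM natrX -[n%:R]sqr_sqrtr //.
  have -> : 4%:R * T%:R ^+ 2 = (2 * T%:R) ^+ 2 :> R by ring.
  rewrite lerXn2r ?nnegrE ?mulr_ge0 ?sqrtr_ge0 //.
  move: T1 Xn S4; clear; lra.
pose P := maxn i`! T.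
have PM' : (P + P <= gap_start alpha i.+1)%N by rewrite addnn -mul2n /P; case: (leqP i`! T).
have Pn' : (4 * P ^ 2 <= n)%N by rewrite /P; case: (leqP i`! T).
have iP : (i`! <= P)%N by exact: leq_maxl.
have := @num_partitions_slots (gapped_set alpha) n P (P + P) P 2 0 1 (gapped_set1 alpha).
rewrite expn0 !muln1 !addn0 => slots.
apply: le_trans (_ : (2 ^ P)%:R <= _); last first.
  rewrite ler_nat; apply: slots => //.
  - by apply: leq_trans iP; exact: fact_gt0.
  - move=> k /andP[Pk kP]; apply: (@gapped_set_block _ _ a01 i).
    by rewrite (leq_ltn_trans iP Pk) (leq_trans kP PM').
  - by move=> k; rewrite ltnNge andNb.
  - by rewrite (_ : P * 2 * (P + P) = 4 * P ^ 2)%N //; ring.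
apply: le_trans (expR_half_le_pow2 P); rewrite ler_expR -mulrA -/X.
have : T%:R <= P%:R :> R by rewrite ler_nat leq_maxr.
by move: T2; clear; lra.
Qed.

(** With N = (i+1)!, take distinct parts from (N, N + r], r = floor(n / (4N)) <= N; their sum is at
    most 4 N r <= n. The constant 1024 gives sqrt(alpha n) L <= n / (32 N), and r >= n / (8 N), so
    2^r is enough. *)
Lemma gapped_partitions_high alpha d L i n : 0 < alpha < 1 -> 0 < d <= 1 / 4 ->
  1 <= L -> 8 <= i.+1%:R * d * alpha -> (n < 4 * i.+1`! ^ 2)%N ->
  1024 * L ^+ 2 * alpha * i.+1`!%:R ^+ 2 <= n%:R ->
  expR (2 * Num.sqrt (alpha * n%:R) * L) <= (num_partitions (gapped_set alpha) n)%:R.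
Proof.
move=> a01 /andP[d0 d1] L1 big nlt nge; have /andP[a0 a1] := a01.
have [_ h2 _ _] := gap_start_bounds a01 d0 big.
have NM := gap_start_double a01 d1 big.
have N0 : (0 < i.+1`!)%N := fact_gt0 _.
have slots := @num_partitions_slots (gapped_set alpha) n i.+1`!.
move: (i.+1`!) (@gapped_set_block _ _ a01 i.+1) nlt nge h2 NM N0 slots => N blk nlt nge h2 NM
  N0 slots.
have N0' : 0 < N%:R :> R by rewrite ltr0n.
pose r := (n %/ (4 * N))%N.
have N40 : (0 < 4 * N)%N by rewrite muln_gt0.
have rn : (r * (4 * N) <= n)%N := leq_trunc_div _ _.
have rn' : (n < r.+1 * (4 * N))%N by apply: ltn_ceil.
have rN : (r <= N)%N.
  have : (n < N * (4 * N))%N by rewrite mulnCA mulnn.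
  by rewrite -ltn_divLR // => /ltnW.
have := slots (N + N)%N r 2%N 0%N 1%N (gapped_set1 alpha).
rewrite expn0 !muln1 !addn0 => {}slots.
apply: le_trans (_ : (2 ^ r)%:R <= _); last first.
  rewrite ler_nat; apply: slots => //.
  - by move=> k /andP[Nk kN]; apply: blk;
    rewrite Nk /= (leq_trans kN) // (leq_trans _ NM) // leq_add2l.
  - by move=> k; rewrite ltnNge andNb.
  - by rewrite leq_add2l.
  - apply: leq_trans rn.
    have -> : (4 * N = 2 * (N + N))%N by rewrite addnn -mul2n mulnA.
    by rewrite -mulnA leq_mul2l leq_mul2l leq_add2l rN !orbT.
apply: le_trans (expR_half_le_pow2 r); rewrite ler_expR.
have n0 : 0 <= n%:R :> R by [].
have q1 : n%:R <= 8 * N%:R * r%:R :> R.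
  have e1 : n%:R <= (r%:R + 1) * (4 * N%:R) :> R.
    by rewrite natr1 -!natrM ler_nat ltnW.
  suff : 8 * N%:R <= n%:R :> R by move: e1; clear; lra.
  apply: le_trans nge.
  have : 1 <= L ^+ 2 by rewrite exprn_ege1.
  have : 8 <= alpha * N%:R.
    have : 0 <= (1 - d) * (alpha * N%:R) by rewrite !mulr_ge0 ?(ltW a0) //; move: d1; clear;
      lra.
    by move: h2; clear; move: (alpha * _) => a; lra.
  have -> : 1024 * L ^+ 2 * alpha * N%:R ^+ 2 = 1024 * L ^+ 2 * (alpha * N%:R) * N%:R by ring.
  move=> aN LL; rewrite ler_pM2r //.
  by move: aN LL; clear; move: (alpha * _) (L ^+ 2) => a b *; nra.
have X1 : Num.sqrt (alpha * n%:R) * L <= n%:R / (32 * N%:R).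
  rewrite -(@ler_pXn2r _ 2) ?nnegrE ?divr_ge0 ?mulr_ge0 ?sqrtr_ge0 //;
    last by apply: le_trans L1.
  rewrite exprMn sqr_sqrtr ?mulr_ge0 ?(ltW a0) // expr_div_n ler_pdivlMr ?exprn_gt0 ?mulr_gt0
    //.
  have -> : alpha * n%:R * L ^+ 2 * (32 * N%:R) ^+ 2 = 1024 * L ^+ 2 * alpha * N%:R ^+ 2 *
    n%:R by ring.
  by rewrite [leRHS]expr2 ler_wpM2r.
rewrite -mulrA; apply: (@le_trans _ _ (2 * (n%:R / (32 * N%:R)))); first by rewrite ler_pM2l.
have -> : 2 * (n%:R / (32 * N%:R)) = n%:R / (16 * N%:R) :> R.
  by move: N0'; clear; move: (N%:R) (n%:R) => x y x0; field; rewrite gt_eqF.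
by rewrite ler_pdivrMr ?mulr_gt0 //; move: q1; clear; lra.
Qed.

(** Each of the M - P + j independent choices has at least e^((1-d) L) outcomes, and M - P + j >= (1
    - 2d) (alpha N + n/N) >= (1 - 2d) 2 sqrt(alpha n). *)
Lemma num_partitions_two_blocks (A : set nat) alpha d L (P N M n : nat) :
  A 1%N -> (forall k, P < k <= M -> A k)%N -> (forall k, N < k <= N + N -> A k)%N ->
  (0 < P)%N -> (M <= N)%N -> (0 < n)%N -> 0 < alpha -> 0 < d <= 1 / 4 -> 0 < L ->
  P%:R <= d * (alpha * N%:R) / 8 -> 1 <= d * (alpha * N%:R) / 8 ->
  alpha * N%:R - d * (alpha * N%:R) / 8 <= M%:R -> M%:R <= alpha * N%:R ->
  expR ((1 - d) * L) <= d / (2048 * alpha * L ^+ 2) ->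
  alpha * N%:R ^+ 2 <= n%:R * (256 * L ^+ 2) ->
  n%:R <= 1024 * L ^+ 2 * alpha * N%:R ^+ 2 ->
  expR ((1 - 4 * d) * (2 * Num.sqrt (alpha * n%:R) * L)) <= (num_partitions A n)%:R.
Proof.
move=> A1 blkP blkN P0 MN n0 a0 /andP[d0 d1] L0 h1 h2 h3 h4.
set B0 := d / _ => dB nge nle.
have n0' : 0 < n%:R :> R by rewrite ltr0n.
have N0 : (0 < N)%N by rewrite lt0n; apply/eqP => E; move: h2; rewrite E !mulr0 mul0r; lra.
have N0' : 0 < N%:R :> R by rewrite ltr0n.
have u0 : 0 < 1 - 2 * d by clear -d1; lra.
have L20 : 0 < L ^+ 2 by rewrite exprn_gt0.
have aN0 : 0 < alpha * N%:R by rewrite mulr_gt0.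
have B1 : 1 <= B0.
  apply: le_trans dB; rewrite -[leLHS]expR0 ler_expR mulr_ge0 ?(ltW L0) //; clear -d1; lra.
have PM : (P <= M)%N.
  rewrite -(ler_nat R); apply: le_trans h1 _; apply: le_trans h3.
  by move: d0 d1 aN0; clear; move: (alpha * _) => a *; nra.
have M0 : 0 < M%:R :> R by rewrite ltr0n (leq_trans P0).
(* The multiplicities below [q] use at most d n of the sum, and the [j] parts above N, all at most
   (1 + d) N, use at most (1 - 2d) (1 + d) n. The bounds on n give 8 [B0] and 2 [B0] for the
   unrounded [q] and [b]; as [B0] >= 1, rounding leaves at least [B0]. *)
pose q := Num.truncn (d * n%:R / M%:R ^+ 2).
pose j := Num.truncn ((1 - 2 * d) * n%:R / N%:R).
pose b := Num.truncn (d * N%:R ^+ 2 / n%:R).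
have qt : 0 <= d * n%:R / M%:R ^+ 2 by rewrite divr_ge0 ?mulr_ge0 ?exprn_ge0 // ltW.
have jt : 0 <= (1 - 2 * d) * n%:R / N%:R by rewrite divr_ge0 ?mulr_ge0 // ltW.
have bt : 0 <= d * N%:R ^+ 2 / n%:R by rewrite divr_ge0 ?mulr_ge0 ?exprn_ge0 // ltW.
have /andP[q1 q2] := truncn_itv qt; have /andP[j1 j2] := truncn_itv jt.
have /andP[b1 b2] := truncn_itv bt.
rewrite -/q -natr1 in q1 q2; rewrite -/j in j1 j2; rewrite -[j.+1%:R]natr1 in j2;
  rewrite -/b -natr1 in b1 b2.
have qB : B0 <= q%:R.
  suff : 8 * B0 <= d * n%:R / M%:R ^+ 2 by move: B1 q2; clear; lra.
  apply: (@le_trans _ _ (d * n%:R / (alpha * N%:R) ^+ 2)); last first.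
    rewrite ler_wpM2l ?mulr_ge0 ?(ltW d0) // lef_pV2 ?posrE ?exprn_gt0 //.
    by rewrite lerXn2r ?nnegrE // ltW.
  rewrite ler_pdivlMr ?exprn_gt0 //.
  have -> : 8 * B0 * (alpha * N%:R) ^+ 2 = d * ((alpha * N%:R ^+ 2) / (256 * L ^+ 2)).
    rewrite /B0; move: a0 L0; clear; move: (N%:R) => x *; field; rewrite !gt_eqF //.
  rewrite (ler_pM2l d0) ler_pdivrMr; [exact: nge|by rewrite mulr_gt0].
have bB : B0 <= b%:R.
  suff : 2 * B0 <= d * N%:R ^+ 2 / n%:R by move: B1 b2; clear; lra.
  rewrite ler_pdivlMr //.
  have -> : d * N%:R ^+ 2 = 2 * B0 * (1024 * L ^+ 2 * alpha * N%:R ^+ 2).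
    rewrite /B0; move: a0 L0; clear; move: (N%:R) => x *; field; rewrite !gt_eqF //.
  by rewrite ler_pM2l // mulr_gt0 // (lt_le_trans _ B1).
have jN : j%:R * N%:R <= (1 - 2 * d) * n%:R by rewrite -ler_pdivlMr.
have jb : j%:R * b%:R <= d * N%:R.
  have : j%:R * b%:R <= ((1 - 2 * d) * n%:R / N%:R) * (d * N%:R ^+ 2 / n%:R) by rewrite ler_pM.
  have -> : ((1 - 2 * d) * n%:R / N%:R) * (d * N%:R ^+ 2 / n%:R) = (1 - 2 * d) * (d * N%:R).
    by move: N0' n0'; clear; move: (N%:R) (n%:R) => x y *; field; rewrite !gt_eqF.
  move=> /le_trans; apply; rewrite ler_piMl ?mulr_ge0 ?(ltW d0) //.
  by move: d0; clear; lra.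
have jbN : (j * b <= N)%N.
  rewrite -(ler_nat R) natrM; apply: le_trans jb _.
  by rewrite ler_piMl //; move: d1; clear; lra.
have slots := @num_partitions_slots A n P N (M - P) q j b A1 P0.
rewrite subnKC // in slots.
have {}slots : (q ^ (M - P) * b ^ j <= num_partitions A n)%N.
  apply: slots => //.
  - by rewrite -(ltr_nat R); apply: lt_le_trans qB; apply: lt_le_trans B1.
  - by move=> k /andP[Nk kN]; apply: blkN; rewrite Nk (leq_trans kN) // leq_add2l.
  - rewrite -(ler_nat R) natrD !natrM natrD natrM natrB //.
    have qM : q%:R * M%:R ^+ 2 <= d * n%:R by rewrite -ler_pdivlMr ?exprn_gt0.
    have s1 : (M%:R - P%:R) * q%:R * M%:R <= d * n%:R.
      apply: le_trans qM.
      have -> : (M%:R - P%:R) * q%:R * M%:R = q%:R * M%:R * (M%:R - P%:R) :> R by ring.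
      by rewrite expr2 mulrA ler_wpM2l ?mulr_ge0 // gerBl.
    have s2 : j%:R * (N%:R + j%:R * b%:R) <= (1 - 2 * d) * n%:R * (1 + d).
      apply: (@le_trans _ _ (j%:R * (N%:R * (1 + d)))).
        by rewrite ler_wpM2l // mulrDr mulr1 lerD2l [leRHS]mulrC.
      by rewrite mulrA ler_wpM2r //; move: d0; clear; lra.
    apply: le_trans (lerD s1 s2) _.
    have : 0 <= d ^+ 2 * n%:R by rewrite mulr_ge0 ?exprn_ge0 // ltW.
    by clear; move: (n%:R) => x; lra.
apply: (@le_trans _ _ ((q ^ (M - P) * b ^ j)%:R)); last by rewrite ler_nat.
rewrite natrM !natrX.
apply: (@le_trans _ _ (expR ((1 - d) * L) ^+ (M - P) * expR ((1 - d) * L) ^+ j)); last first.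
  apply: ler_pM; rewrite ?exprn_ge0 ?expR_ge0 //; apply: lerXn2r;
    rewrite ?nnegrE ?expR_ge0 //; exact: le_trans dB _.
rewrite -exprD -expRM_natl ler_expR natrD natrB //.
have X0 : 0 <= Num.sqrt (alpha * n%:R) by exact: sqrtr_ge0.
have amgm : 2 * Num.sqrt (alpha * n%:R) <= alpha * N%:R + n%:R / N%:R.
  rewrite -(@ler_pXn2r _ 2) ?nnegrE ?mulr_ge0 ?addr_ge0 ?divr_ge0 ?(ltW aN0) //.
  rewrite exprMn sqr_sqrtr ?mulr_ge0 ?(ltW a0) //.
  have -> : alpha * n%:R = (alpha * N%:R) * (n%:R / N%:R).
    by move: N0'; clear; move: (N%:R) (n%:R) => x y *; field; rewrite gt_eqF.
  move: (alpha * _) (_ / _) => x y; have := sqr_ge0 (x - y); clear; lra.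
have rj : (1 - 2 * d) * (2 * Num.sqrt (alpha * n%:R)) <= M%:R - P%:R + j%:R.
  apply: le_trans (_ : (1 - 2 * d) * (alpha * N%:R + n%:R / N%:R) <= _).
    by rewrite ler_pM2l.
  have -> : (1 - 2 * d) * (alpha * N%:R + n%:R / N%:R)
      = (1 - 2 * d) * (alpha * N%:R) + (1 - 2 * d) * n%:R / N%:R by ring.
  have dN : 0 <= d * (alpha * N%:R) by rewrite mulr_ge0 // ltW.
  move: h1 h2 h3 j2 dN; clear; move: (alpha * N%:R) ((1 - 2 * d) * _ / _) => x y.
  move: (P%:R) (M%:R) (j%:R) => p m k; lra.
have LX : 0 <= Num.sqrt (alpha * n%:R) * L by rewrite mulr_ge0 // ltW.
apply: (@le_trans _ _ ((1 - 2 * d) * (2 * Num.sqrt (alpha * n%:R)) * ((1 - d) * L)));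
  last first.
  by rewrite ler_pM2r // mulr_gt0 //; move: d1; clear; lra.
move: LX d0; clear; move: (Num.sqrt _) => x LX d0.
have : 0 <= d * (x * L) by rewrite mulr_ge0 // ltW.
have : 0 <= d ^+ 2 * (x * L) by rewrite mulr_ge0 // exprn_ge0 // ltW.
lra.
Qed.

Lemma gapped_partitions_mid alpha d L i n : 0 < alpha < 1 -> 0 < d <= 1 / 4 ->
  0 < L -> 8 <= i.+1%:R * d * alpha -> (0 < n)%N ->
  expR ((1 - d) * L) <= d / (2048 * alpha * L ^+ 2) ->
  alpha * i.+1`!%:R ^+ 2 <= n%:R * (256 * L ^+ 2) ->
  n%:R <= 1024 * L ^+ 2 * alpha * i.+1`!%:R ^+ 2 ->
  expR ((1 - 4 * d) * (2 * Num.sqrt (alpha * n%:R) * L))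
  <= (num_partitions (gapped_set alpha) n)%:R.
Proof.
move=> a01 d01 L0 big n0 dB nge nle; have /andP[a0 a1] := a01; have /andP[d0 d1] := d01.
have [h1 h2 h3 h4] := gap_start_bounds a01 d0 big.
apply: (num_partitions_two_blocks (gapped_set1 alpha) _ _ (fact_gt0 i) _ n0
  a0 d01 L0 h1 h2 h3 h4 dB nge nle).
- exact: gapped_set_block.
- move=> k /andP[Nk kN]; apply: (@gapped_set_block _ _ a01 i.+1); rewrite Nk /=.
  exact: leq_trans kN (gap_start_double a01 d1 big).
- exact: gap_start_le.
Qed.

End GappedPartitions.

(** * Lower bound for the ratio *)

Section RatioLowerBound.
Variable R : realType.
Implicit Types (alpha d L : R) (n : nat).

Lemma gapped_partitions_ge alpha d L : 0 < alpha < 1 -> 0 < d <= 1 / 4 -> 1 <= L ->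
  expR ((1 - d) * L) <= d / (2048 * alpha * L ^+ 2) ->
  exists n0, forall n, (n0 <= n)%N ->
  expR ((1 - 4 * d) * (2 * Num.sqrt (alpha * n%:R) * L))
  <= (num_partitions (gapped_set alpha) n)%:R.
Proof.
move=> a01 d01 L1 dB; have /andP[a0 a1] := a01; have /andP[d0 d1] := d01.
have L0 : 0 < L by apply: lt_le_trans L1.
have L20 : 0 < L ^+ 2 by rewrite exprn_gt0.
have aL : 16 * (Num.sqrt alpha * L) <= 1.
  rewrite -(@ler_pXn2r _ 2) ?nnegrE ?mulr_ge0 ?sqrtr_ge0 ?(ltW L0) //.
  rewrite !exprMn sqr_sqrtr ?(ltW a0) // expr1n.
  have : 1 <= d / (2048 * alpha * L ^+ 2).
    by apply: le_trans dB; rewrite -[leLHS]expR0 ler_expR mulr_ge0 ?(ltW L0) //; clear -d1; lra.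
  have k0 : 0 < 2048 :> R by rewrite ltr0n.
  rewrite (ler_pdivlMr _ _ (mulr_gt0 (mulr_gt0 k0 a0) L20)).
  by rewrite mul1r -mulrA; move: d1; clear; move: (alpha * _) => x; lra.
pose K := Num.bound (8 / (d * alpha)).
exists (16 + 4 * K`! ^ 2)%N => n nK.
have n16 : (16 <= n)%N := leq_trans (leq_addr _ _) nK.
have {}nK : (4 * K`! ^ 2 <= n)%N := leq_trans (leq_addl _ _) nK.
(* The scale N = (i+1)! is fixed by 4 (i!)^2 <= n < 4 N^2: the left bound is what the low range
   needs, the right one what the high range needs. *)
have [||i /andP[in1 in2]] := @exists_step (fun j => 4 * j`! ^ 2)%N n.
- exact: leq_trans _ n16.
- exists n.+1; apply: leq_trans (leq_self_fact n.+1) _.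
  by rewrite -mulnn mulnA leq_pmull // muln_gt0 fact_gt0.
have Ki : (K <= i.+1)%N.
  rewrite leqNgt; apply/negP => iK; move: in2; apply/negP; rewrite -leqNgt.
  by apply: leq_trans nK; rewrite leq_mul2l /= leq_exp2r //; apply: fact_nd; exact: ltnW.
have big : 8 <= i.+1%:R * d * alpha.
  rewrite -mulrA -ler_pdivrMr ?mulr_gt0 //.
  have h0 : 0 <= 8 / (d * alpha) by rewrite divr_ge0 ?mulr_ge0 // ltW.
  by apply: le_trans (ltW (archi_boundP h0)) _; rewrite ler_nat.
have weaken : expR ((1 - 4 * d) * (2 * Num.sqrt (alpha * n%:R) * L))
    <= expR (2 * Num.sqrt (alpha * n%:R) * L).
  rewrite ler_expR ler_piMl ?mulr_ge0 ?sqrtr_ge0 ?(ltW L0) //.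
  by clear -d0; lra.
have [low|/ltW nlow] := leP (n%:R * (256 * L ^+ 2)) (alpha * i.+1`!%:R ^+ 2).
  exact: le_trans weaken (gapped_partitions_low a01 d01 L0 big aL n16 in1 low).
have [high|/ltW nhigh] := leP (1024 * L ^+ 2 * alpha * i.+1`!%:R ^+ 2) n%:R.
  exact: le_trans weaken (gapped_partitions_high a01 d01 L1 big in2 high).
exact: gapped_partitions_mid a01 d01 L0 big (leq_trans _ n16) dB nlow nhigh.
Qed.

Lemma partition_number_gt1 : exists m0, forall m, (m0 <= m)%N -> (1 < partition_number m)%N.
Proof.
have [m0 Hm0] := @partition_number_ge R (1 / 2) ltac:(lra) ltac:(lra).
exists m0.+1 => m mm; rewrite -(ltr_nat R).
apply: lt_le_trans (Hm0 m (ltnW mm)); rewrite expR_gt1.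
have sm : 0 < Num.sqrt m%:R :> R by rewrite sqrtr_gt0 ltr0n (leq_trans _ mm).
have s6 : 0 < Num.sqrt 6 :> R by rewrite sqrtr_gt0.
by rewrite mulr_gt0 ?mulr_gt0 ?divr_gt0 ?mulr_gt0 ?pi_gt0 //; lra.
Qed.

Lemma gapped_log_ratio_ge alpha c x : 0 < alpha -> 0 <= c ->
  c * (2 * pi / Num.sqrt 6) <= x ->
  (exists n0, forall n, (n0 <= n)%N ->
     expR (x * Num.sqrt (alpha * n%:R)) <= (num_partitions (gapped_set alpha) n)%:R) ->
  (c%:E <= limn_einf (log_ratio (gapped_set alpha) alpha))%E.
Proof.
move=> a0 c0 cx [n0 Hn0]; have [m0 Hm0] := partition_number_gt1.
pose W : R := m0.+1%:R / alpha.
have W0 : 0 <= W by rewrite divr_ge0 // ltW.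
apply: limn_einf_ge; exists (n0 + Num.bound W)%N => // n /= nn.
have an : m0.+1%:R <= alpha * n%:R.
  rewrite mulrC -ler_pdivrMr //; apply: le_trans (ltW (archi_boundP W0)) _.
  by rewrite ler_nat (leq_trans (leq_addl n0 _)).
have an0 : 0 <= alpha * n%:R by rewrite mulr_ge0 // ltW.
have mm : (m0.+1 <= Num.truncn (alpha * n%:R))%N by rewrite truncn_ge_nat.
have /andP[m1 _] := truncn_itv an0; move: mm m1.
have nn0 : (n0 <= n)%N by apply: leq_trans nn; exact: leq_addr.
set m := Num.truncn _ => mm m1.
apply: (@log_ratio_ge R _ alpha n c _ (2 * pi / Num.sqrt 6 * Num.sqrt m%:R) c0 _ (Hn0 n nn0)).
- have k0 : 0 <= 2 * pi / Num.sqrt 6 :> R.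
    by rewrite divr_ge0 ?sqrtr_ge0 // mulr_ge0 // pi_ge0.
  rewrite mulrA; apply: ler_pM cx (ler_wsqrtr m1); last exact: sqrtr_ge0.
  exact: mulr_ge0.
- by apply: Hm0; exact: ltnW.
- by apply: num_partitions_le; [move=> k|apply: leq_trans mm].
Qed.

(** The set depends on alpha alone and not on the error, so a single set serves all errors and the
    error can be selected afterwards. *)
Lemma exists_eps1 : exists2 eps : R -> R, eps a @[a --> 0^'+] --> (0 : R) &
  forall alpha, 0 < alpha < 1 ->
    (((1 - eps alpha) * (Num.sqrt 6 / pi) * ln (1 / alpha))%:E
     <= limn_einf (log_ratio (gapped_set alpha) alpha))%E.
Proof.
have p0 := pi_gt0 R.
have s60 : 0 < Num.sqrt 6 :> R by rewrite sqrtr_gt0.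
have s6 : 0 < Num.sqrt 6 / pi :> R by rewrite divr_gt0.
apply: (@select_vanishing R (fun alpha e =>
  (((1 - e) * (Num.sqrt 6 / pi) * ln (1 / alpha))%:E
   <= limn_einf (log_ratio (gapped_set alpha) alpha))%E)).
- move=> a e e' /andP[a0 a1] ee'; apply: le_trans.
  rewrite lee_fin ler_wpM2r //; last by rewrite ler_pM2r // lerD2l lerN2.
  by rewrite ln_ge0 // div1r invf_ge1 // ltW.
(* The error 1 is always admissible: the bound becomes 0, and there is at least the partition of n
   into ones. *)
- move=> a /andP[a0 a1]; exists 1; rewrite subrr !mul0r.
  apply: (@gapped_log_ratio_ge _ _ 0) => //; first by rewrite mul0r.
  by exists 0%N => n _; rewrite mul0r expR0 ler1n gapped_num_partitions_gt0.
- move=> e e0; pose d := Num.min (1 / 4) (e / 4).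
  have d0 : 0 < d by rewrite lt_min; apply/andP; split; lra.
  have d1 : d <= 1 / 4 by rewrite ge_min lexx.
  have d2 : d <= e / 4 by rewrite ge_min lexx orbT.
  (* From e^x >= x^3 / 6 at x = d L, the bound required by [gapped_partitions_ge]
     holds as soon as d^4 L >= 6 * 2048. *)
  exists (expR (- (12288 / d ^+ 4))); first exact: expR_gt0.
  move=> a a01 aE; have /andP[a0 a1] := a01.
  set L := ln (1 / a).
  have d40 : 0 < d ^+ 4 by rewrite exprn_gt0.
  have dL : 12288 / d ^+ 4 <= L.
    rewrite -(expRK (12288 / d ^+ 4)) ler_ln ?posrE ?expR_gt0 ?divr_gt0 //.
    by rewrite div1r -[expR _]invrK -expRN lef_pV2 ?posrE ?expR_gt0.
  have L1 : 1 <= L.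
    apply: le_trans dL; rewrite ler_pdivlMr // mul1r.
    have : d ^+ 4 <= 1 by rewrite exprn_ile1 ?(ltW d0) //; clear -d1; lra.
    clear; lra.
  have L0 : 0 < L by apply: lt_le_trans L1.
  have eL : expR L = a^-1 by rewrite /L div1r lnK // posrE invr_gt0.
  have dB : expR ((1 - d) * L) <= d / (2048 * a * L ^+ 2).
    rewrite mulrBl mul1r expRB eL.
    have L20 : 0 < L ^+ 2 by rewrite exprn_gt0.
    have d40L : 12288 <= d ^+ 4 * L by rewrite mulrC -ler_pdivrMr.
    have E3 : d * ((d * L) ^+ 3 / 6) <= d * expR (d * L).
      rewrite ler_pM2l //; apply: le_trans (expR_ge1Dxn 2 _); last by rewrite mulr_ge0 // ltW.
      by rewrite (_ : 3`!%:R = 6) // lerDr.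
    have E2 : 2048 * L ^+ 2 <= d * expR (d * L).
      apply: le_trans E3; have : 12288 * L ^+ 2 <= d ^+ 4 * L * L ^+ 2 by rewrite ler_pM2r.
      clear; lra.
    have -> : d / (2048 * a * L ^+ 2) = a^-1 * (d / (2048 * L ^+ 2)).
      by move: a0 L0; clear; move: L => l *; field; rewrite !gt_eqF.
    have k0 : 0 < 2048 :> R by rewrite ltr0n.
    have ia0 : 0 < a^-1 by rewrite invr_gt0.
    rewrite (ler_pM2l ia0) (ler_pdivlMr _ _ (mulr_gt0 k0 L20)) mulrC.
    by rewrite (ler_pdivrMr _ _ (expR_gt0 _)).
  have d01 : 0 < d <= 1 / 4 by apply/andP.
  have [n0 Hn0] := gapped_partitions_ge a01 d01 L1 dB.
  apply: le_trans (_ : (((1 - 4 * d) * (Num.sqrt 6 / pi) * L)%:E <= _)%E).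
    rewrite lee_fin ler_wpM2r ?(ltW L0) // ler_pM2r //; clear -d2; lra.
  have f0 : 0 <= 1 - 4 * d by clear -d1; lra.
  apply: (@gapped_log_ratio_ge _ _ ((1 - 4 * d) * 2 * L)) => //.
  + exact: mulr_ge0 (mulr_ge0 f0 (ltW s6)) (ltW L0).
  + rewrite le_eqVlt; apply/orP; left; apply/eqP.
    move: p0 s60; clear; move: (pi : R) (Num.sqrt 6) => p s p0 s0; field.
    by rewrite (gt_eqF p0) (gt_eqF s0).
  + exists n0 => n nn; apply: le_trans (Hn0 n nn).
    by rewrite ler_expR le_eqVlt; apply/orP; left; apply/eqP; ring.
Qed.

End RatioLowerBound.

Theorem theorem1p3 (R : realType) :
  exists eps1 eps2 : R -> R,
    [/\ eps1 alpha @[alpha --> 0^'+] --> (0 : R),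
        eps2 alpha @[alpha --> 0^'+] --> (0 : R) &
        forall alpha : R, 0 < alpha < 1 ->
          (exists A : set nat,
             [/\ all_positive A,
                 natural_lower_density R A = alpha%:E,
                 is_gcd A 1 &
                 (((1 - eps1 alpha) * (Num.sqrt 6 / pi) * ln (1 / alpha))%:E
                  <= limn_einf (log_ratio A alpha))%E]) /\
          (forall A : set nat,
             all_positive A ->
             natural_lower_density R A = alpha%:E ->
             (limn_einf (log_ratio A alpha)
              <= ((1 + eps2 alpha) * (Num.sqrt 6 / pi) * ln (1 / alpha))%:E)%E)].
Proof.
have [eps1 eps1_0 lower] := exists_eps1 R.
have [eps2 eps2_0 upper] := exists_eps2 R.
exists eps1, eps2; split => // alpha a01; split; last exact: upper.
exists (gapped_set alpha); split.
- exact: gapped_set_positive.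
- exact: gapped_set_density.
- exact: gapped_set_gcd.
- exact: lower.
Qed.
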